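(* Let $X\subset\mathbb Z^n$ be a finite digital image with $c_1$-adjacency, where $n\le4$, and let $f:X\to X$ be continuous with $|\bar L(f)|=k$. Then there are at least $k$ distinct elementary cubes $\sigma\subseteq X$ with $f(\sigma)=\sigma$.
   Context: On $\mathbb Z^n$, the $c_1$-adjacency declares two points adjacent iff they differ by $\pm1$ in exactly one coordinate and agree in all others. Write $x\leftrightarrow y$ for adjacent and $x\Leftrightarrow y$ for adjacent or equal; a map is continuous if $x\leftrightarrow y$ implies $f(x)\Leftrightarrow f(y)$. Cubical homology: an elementary interval is $\{a,a+1\}$ (nondegenerate) or $\{a\}$ (degenerate), $a\in\mathbb Z$; an elementary cube is $\sigma=t_1\times\dots\times t_n$ with each $t_i$ an elementary interval, and its dimension $q$ is the number of nondegenerate factors. $\bar C_q(X)$ is the free abelian group on the elementary $q$-cubes contained in $X$. With $A_i\sigma$ (resp. $B_i\sigma$) obtained by replacing $t_i$ by $\{\min t_i\}$ (resp. $\{\max t_i\}$), and $j_1<\dots<j_q$ the indices of nondegenerate factors, $\partial\sigma=\sum_{i=1}^q(-1)^i(A_{j_i}\sigma-B_{j_i}\sigma)$; $\bar H_q(X)$ is the homology. For continuous $f:X\to X$, define $\bar f_q(\sigma)=0$ if $f(\sigma)$ is not an elementary $q$-cube; otherwise $\tau=f(\sigma)$ is a $q$-cube, and identifying $\sigma$ and $\tau$ with $\{0,1\}^q$ via their nondegenerate coordinates (in increasing order, shifted by their minima), $f|_\sigma$ has the form $(x_1,\dots,x_q)\mapsto(y_1,\dots,y_q)$ with each $y_i\in\{x_{\pi(i)},1-x_{\pi(i)}\}$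 for a permutation $\pi$; set $\bar f_q(\sigma)=\operatorname{sgn}(\pi)(-1)^r\tau$, where $r$ is the number of $i$ with $y_i=1-x_{\pi(i)}$. It is known that for $n\le4$ these $\bar f_q$ form a chain map, inducing $\bar f_{*,q}$ on $\bar H_q(X)$. The cubical Lefschetz number is $\bar L(f)=\sum_{q\ge0}(-1)^q\operatorname{tr}(\bar f_{*,q})$, traces taken on $\bar H_q(X)\otimes\mathbb Q$. *)

(* Defs.v *)
From HB Require Import structures.
From mathcomp Require Import all_boot all_order all_algebra all_fingroup.
Set Implicit Arguments. Unset Strict Implicit. Unset Printing Implicit Defensive.
Import Order.TTheory GRing.Theory Num.Theory.
Local Open Scope ring_scope.

Definition point (n : nat) := (n.-tuple int)%type.

Definition c1adj (n : nat) (x y : point n) : bool :=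
  [exists i : 'I_n, (`|x`_i - y`_i| == 1) &&
     [forall j : 'I_n, (j != i) ==> (x`_j == y`_j)]].

Definition c1adjeq (n : nat) (x y : point n) : bool := (x == y) || c1adj x y.

(* f : X -> X (given as a total map on Z^n mapping X into X) is continuous. *)
Definition c1_continuous (n : nat) (X : seq (point n)) (f : point n -> point n) : Prop :=
  (forall x, x \in X -> f x \in X) /\
  (forall x y, x \in X -> y \in X -> c1adj x y -> c1adjeq (f x) (f y)).

(* An elementary cube t_1 x ... x t_n is encoded canonically by its minimal
   corner a and the flags d (d_i = true iff t_i = {a_i, a_i+1} is nondegenerate). *)
Definition cube (n : nat) := (point n * n.-tuple bool)%type.

Definition ndi (n : nat) (d : n.-tuple bool) : seq nat := [seq k <- iota 0 n | nth false d k].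
Definition cdim (n : nat) (c : cube n) : nat := size (ndi c.2).

(* vertex of the cube identified with x in {0,1}^q (q = cdim c), via the
   nondegenerate coordinates in increasing order, shifted by the minima *)
Definition vertex (n : nat) (c : cube n) (x : seq bool) : point n :=
  [tuple (c.1`_i + (if nth false c.2 i then (nat_of_bool (nth false x (index (val i) (ndi c.2))))%:Z
                    else 0)) | i < n].

Definition in_cube (n : nat) (t : cube n) (p : point n) : bool :=
  [forall i : 'I_n, (p`_i == t.1`_i) || (nth false t.2 i && (p`_i == t.1`_i + 1))].

Definition cube_in (n : nat) (X : seq (point n)) (c : cube n) : bool :=
  [forall x : (cdim c).-tuple bool, vertex c x \in X].

Definition img_eq (n : nat) (f : point n -> point n) (s t : cube n) : bool :=
  [forall x : (cdim s).-tuple bool, in_cube t (f (vertex s x))] &&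
  [forall y : (cdim t).-tuple bool, exists x : (cdim s).-tuple bool,
      f (vertex s x) == vertex t y].

Definition coords (n : nat) (t : cube n) (p : point n) : seq bool :=
  [seq (p`_k == t.1`_k + 1) | k <- ndi t.2].

(* sgn(pi) (-1)^r where f|_s : (x_1..x_q) |-> (y_1..y_q), y_i = x_{pi i} xor flip_i *)
Definition fsign (n : nat) (f : point n -> point n) (s t : cube n) : rat :=
  let q := cdim s in
  match [pick ps : {perm 'I_q} * q.-tuple bool |
          [forall x : q.-tuple bool, forall i : 'I_q,
             nth false (coords t (f (vertex s x))) i == (tnth x (ps.1 i) (+) tnth ps.2 i)]] with
  | Some ps => (-1) ^+ (odd_perm ps.1) * (-1) ^+ (count id ps.2)
  | None => 0
  end.

Definition fcoef (n : nat) (f : point n -> point n) (s t : cube n) : rat :=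
  if (cdim t == cdim s) && img_eq f s t then fsign f s t else 0.

Definition faceA (n : nat) (c : cube n) (j : nat) : cube n :=
  (c.1, [tuple (nth false c.2 i && (val i != j)) | i < n]).
Definition faceB (n : nat) (c : cube n) (j : nat) : cube n :=
  ([tuple (c.1`_i + (nat_of_bool (val i == j))%:Z) | i < n],
   [tuple (nth false c.2 i && (val i != j)) | i < n]).

Definition bcoef (n : nat) (s t : cube n) : rat :=
  \sum_(l < cdim s) (-1) ^+ (l.+1) *
     (((faceA s (nth 0%N (ndi s.2) l) == t) : nat)%:R
      - ((faceB s (nth 0%N (ndi s.2) l) == t) : nat)%:R).

Definition cubes (n : nat) (X : seq (point n)) (q : nat) : seq (cube n) :=
  undup [seq c <- [seq (a, d) | a <- X, d <- enum {: n.-tuple bool}] |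
          (cdim c == q) && cube_in X c].

Definition ncubes (n : nat) (X : seq (point n)) (q : nat) := size (cubes X q).

Definition cube0 (n : nat) : cube n := ([tuple 0 | _ < n], [tuple false | _ < n]).

(* matrices act on row vectors: row s is the image of the basis cube s *)
Definition bdmx (n : nat) (X : seq (point n)) (q : nat) :
  'M[rat]_(ncubes X q, ncubes X q.-1) :=
  \matrix_(i, j) bcoef (nth (cube0 n) (cubes X q) i) (nth (cube0 n) (cubes X q.-1) j).

Definition chmx (n : nat) (X : seq (point n)) (f : point n -> point n) (q : nat) :
  'M[rat]_(ncubes X q) :=
  \matrix_(i, j) fcoef f (nth (cube0 n) (cubes X q) i) (nth (cube0 n) (cubes X q) j).

(* trace of the map induced by bar f_q on bar H_q(X) (x) Q = Z_q / B_q: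
   W is a basis of a complement of B_q in Z_q (so its image is a basis of H_q);
   the matrix of the induced map in that basis is the W-block of the
   coordinates of W *m F in the basis (W ; basis of B_q) of Z_q. *)
Definition htrace (n : nat) (X : seq (point n)) (f : point n -> point n) (q : nat) : rat :=
  let Z := kermx (bdmx X q) in
  let B : 'M[rat]_(ncubes X q.+1, ncubes X q) := bdmx X q.+1 in
  let W := row_base (Z :\: B)%MS in
  let M := col_mx W (row_base B) in
  \tr (lsubmx (W *m chmx X f q *m pinvmx M)).

(* cubical Lefschetz number; cubes of dimension > n do not exist *)
Definition lefschetz (n : nat) (X : seq (point n)) (f : point n -> point n) : rat :=
  \sum_(q < n.+1) (-1) ^+ q * htrace X f q.

(* Main.v *)
Require Import Defs.
From HB Require Import structures.
From mathcomp Require Import all_boot all_order all_algebra all_fingroup.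
From mathcomp Require Import zify ring.
Set Implicit Arguments. Unset Strict Implicit. Unset Printing Implicit Defensive.
Import Order.TTheory GRing.Theory Num.Theory.
Local Open Scope ring_scope.

(** The maps induced by [f] form a chain map, in every dimension [n].  If [f]
    maps a cube [s] onto a cube, it acts there as a signed permutation of the
    coordinates, whose sign is a determinant, and Laplace expansion gives
    compatibility with the boundary.  Otherwise, by induction on the dimension,
    the image of the boundary of [s] is a cycle, so its support has no free face.
    A nonempty finite set of [k]-cubes without free face has at least [2 (k + 1)]
    elements; as [s] has that many faces, all of them would be mapped onto
    distinct cubes, which forces [f s] to be a cube.  Hence the image is zero.

    The Hopf trace formula then rewrites the Lefschetz number as the alternating
    sum of the traces on chains, whose nonzero diagonal entries are signs
    attached to the cubes with [f c = c]. *)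

(** * The Hopf trace formula *)

(** The obstacle is a cube [s] whose image is not a cube of its dimension: no formula for [f] on [s]
    is then available, only continuity along edges. What replaces a case analysis is a local
    criterion: a continuous map on the vertices of a cube is a signed permutation as soon as it is
    injective on pairs of vertices that differ in at most two coordinates, because images of unit
    squares then determine everything. In dimension at least two such a pair lies in a common facet,
    except for the diagonals of a square. Good behaviour on all facets therefore nearly suffices,
    and distinctness of their images settles the diagonals. Edges are treated apart, since [0]-cubes
    have no faces. *)

Section HopfTrace.
Variable K : fieldType.

(** Additivity of the trace along the kernel and the image of [d]: the quotient by the kernel is
    identified with the image, where [F] becomes [F']. *)
Lemma mxtrace_ker_im (N N' z : nat) (F : 'M[K]_N) (F' : 'M[K]_N')
    (d : 'M[K]_(N, N')) (V : 'M[K]_(z, N)) :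
  F *m d = d *m F' -> row_free V -> (V :=: kermx d)%MS ->
  \tr F = \tr (V *m F *m pinvmx V) +
          \tr (row_base d *m F' *m pinvmx (row_base d)).
Proof.
move=> Fd Vfree Vker; set E := row_base d.
have EpE : E *m pinvmx E = 1%:M by apply: mulmxVp; exact: row_base_free.
have VpV : V *m pinvmx V = 1%:M by exact: mulmxVp.
have Vd : V *m d = 0 by apply/sub_kermxP; rewrite Vker.
pose U := E *m pinvmx d; pose L := d *m pinvmx E.
have Ud : U *m d = E by rewrite mulmxKpV // eq_row_base.
have LE : L *m E = d by rewrite mulmxKpV // eq_row_base.
(* [U] lifts the basis [E] through [d], so [1 - L *m U] is the projection onto the kernel along that
   lift, and [H] gives its coordinates in [V]. Thus [H *m V + L *m U = 1] splits the trace. *)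
pose H := (1%:M - L *m U) *m pinvmx V.
have HV : H *m V = 1%:M - L *m U.
  rewrite mulmxKpV // Vker; apply/sub_kermxP.
  by rewrite mulmxBl mul1mx -mulmxA Ud LE subrr.
have VH : V *m H = 1%:M.
  have VL : V *m L = 0 by rewrite mulmxA Vd mul0mx.
  by rewrite mulmxA mulmxBr mulmx1 (mulmxA V) VL mul0mx subr0.
have VF : V *m F *m pinvmx V *m V = V *m F.
  rewrite mulmxKpV // Vker; apply/sub_kermxP.
  by rewrite -mulmxA Fd mulmxA Vd mul0mx.
have -> : \tr F = \tr (F *m H *m V) + \tr (F *m L *m U).
  by rewrite -raddfD /= -(mulmxA F H) -(mulmxA F L) -mulmxDr HV subrK mulmx1.
congr (_ + _); rewrite mxtrace_mulC (mulmxA _ F).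
  by rewrite -[in LHS]VF -(mulmxA _ V) VH mulmx1.
by rewrite (mulmxA _ d) -(mulmxA U) Fd mulmxA Ud.
Qed.

(** Since [R] is invariant, the matrix in the basis [(W ; R)] is block triangular; its [W]-block is
    the action on the quotient. *)
Lemma mxtrace_quotient (N w r : nat) (F : 'M[K]_N)
    (W : 'M[K]_(w, N)) (R : 'M[K]_(r, N)) :
  row_free (col_mx W R) -> (R *m F <= R)%MS -> row_free R ->
  \tr (col_mx W R *m F *m pinvmx (col_mx W R)) =
  \tr (lsubmx (W *m F *m pinvmx (col_mx W R))) + \tr (R *m F *m pinvmx R).
Proof.
set M := col_mx W R => Mfree RF Rfree.
have MpM : M *m pinvmx M = 1%:M by exact: mulmxVp.
have RpM : R *m pinvmx M = row_mx 0 1%:M.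
  have := congr1 dsubmx MpM.
  by rewrite -mul_dsub_mx col_mxKd scalar_mx_block block_mxEv col_mxKd.
rewrite /M !mul_col_mx -/M -[in LHS](hsubmxK (W *m F *m _)).
rewrite -[in LHS](mulmxKpV RF) -(mulmxA _ R) RpM.
by rewrite mul_mx_row mulmx0 mulmx1 -block_mxEv mxtrace_block.
Qed.

(** Chains modulo cycles are the boundaries one degree lower, and cycles modulo boundaries are the
    homology. [W] and [M] are chosen to match [htrace] literally. *)
Lemma mxtrace_homology (N N' N'' : nat) (F : 'M[K]_N) (F' : 'M[K]_N')
    (F'' : 'M[K]_N'') (d : 'M[K]_(N, N')) (d' : 'M[K]_(N'', N)) :
  d' *m d = 0 -> F *m d = d *m F' -> F'' *m d' = d' *m F ->
  let W := row_base (kermx d :\: d')%MS in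
  let M := col_mx W (row_base d') in
  \tr F = \tr (lsubmx (W *m F *m pinvmx M)) +
    \tr (row_base d' *m F *m pinvmx (row_base d')) +
    \tr (row_base d *m F' *m pinvmx (row_base d)).
Proof.
move=> dd Fd Fd' W M.
have d'Z : (d' <= kermx d)%MS by apply/sub_kermxP.
have Meq : (M :=: kermx d)%MS.
  apply: eqmx_trans (eqmx_sym (addsmxE _ _)) _.
  apply: eqmx_trans (adds_eqmx (eq_row_base _) (eq_row_base _)) _.
  apply: eqmx_trans (addsmx_diff_cap_eq (kermx d) d').
  by apply: adds_eqmx => //; apply: eqmx_sym; apply/capmx_idPr.
have Mfree : row_free M.
  rewrite -row_leq_rank -addsmxE (adds_eqmx (eq_row_base _) (eq_row_base _)).
  by rewrite mxrank_disjoint_sum // capmx_diff.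
have Rst : (row_base d' *m F <= row_base d')%MS.
  rewrite (eqmxMr F (eq_row_base d')) eq_row_base -Fd'; exact: submxMl.
rewrite (mxtrace_ker_im Fd Mfree Meq); congr (_ + _).
by rewrite mxtrace_quotient // row_base_free.
Qed.

End HopfTrace.

(** * Cubes, vertices and faces *)

Section Cubes.
Variable n : nat.
Implicit Types (p : point n) (c s t : cube n) (A B D E : {set 'I_n}) (i j : 'I_n).

Definition dirs c : {set 'I_n} := [set i : 'I_n | nth false c.2 i].

(** Vertices are indexed by sets of directions instead of bit tuples, so that passing to a face does
    not renumber coordinates. *)
Definition vtx c A : point n := [tuple c.1`_i + (i \in A)%:Z | i < n].

Definition face c j (b : bool) : cube n :=
  (vtx c (if b then [set j] else set0),
   [tuple nth false c.2 i && (i != j) | i < n]).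

Lemma point_eqP p p' : (forall i, p`_i = p'`_i) -> p = p'.
Proof. by move=> e; apply: eq_from_tnth => i; rewrite !(tnth_nth 0). Qed.

Lemma vtxE c A i : (vtx c A)`_i = c.1`_i + (i \in A)%:Z.
Proof. by rewrite nth_mktuple. Qed.

Lemma vtx0 c : vtx c set0 = c.1.
Proof. by apply: point_eqP => i; rewrite vtxE inE addr0. Qed.

Lemma vtx_inj c : injective (vtx c).
Proof.
move=> A B e; apply/setP => i; have := congr1 (fun p : point n => p`_i) e.
by rewrite /= !vtxE => /addrI; case: (i \in A); case: (i \in B).
Qed.

Lemma cube_eqP s t : s.1 = t.1 -> dirs s = dirs t -> s = t.
Proof.
case: s t => [a d] [a' d'] /= -> e; congr pair.
apply: eq_from_tnth => i; move/setP/(_ i): e.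
by rewrite !inE !(tnth_nth false).
Qed.

Lemma dirs_mk p (D : {set 'I_n}) : dirs (p, [tuple i \in D | i < n]) = D.
Proof. by apply/setP => i; rewrite inE nth_mktuple. Qed.

Lemma dirs_face c j b : dirs (face c j b) = dirs c :\ j.
Proof. by apply/setP => i; rewrite !inE nth_mktuple andbC. Qed.

Lemma face1E c j b i : (face c j b).1`_i = c.1`_i + ((i == j) && b)%:Z.
Proof. by rewrite vtxE; case: b; rewrite inE ?andbT ?andbF. Qed.

Lemma vtx_face c j b A : j \notin A ->
  vtx (face c j b) A = vtx c (if b then j |: A else A).
Proof.
move=> jA; apply: point_eqP => i; rewrite vtxE face1E [RHS]vtxE -addrA; congr (_ + _).
case: b; rewrite ?inE ?andbT ?andbF ?add0r //.
by have [->|//] := eqVneq i j; rewrite (negbTE jA).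
Qed.

Lemma faceAE c j : faceA c j = face c j false.
Proof. by congr pair; rewrite vtx0. Qed.

Lemma faceBE c j : faceB c j = face c j true.
Proof. by congr pair; apply: point_eqP => i; rewrite vtxE nth_mktuple inE. Qed.

Lemma face_inj c j j' b b' : j \in dirs c -> j' \in dirs c ->
  face c j b = face c j' b' -> j = j' /\ b = b'.
Proof.
move=> jc j'c e; have /setP/(_ j) := congr1 dirs e.
rewrite !dirs_face !inE eqxx /= => /esym/negbT; rewrite negb_and negbK.
rewrite inE in jc; rewrite jc orbF => /eqP jj; split=> //.
have := congr1 (fun c : cube n => c.1`_j) e.
by rewrite /= !face1E -jj eqxx /= => /addrI; case: b {e}; case: b'.
Qed.

Lemma ndiE c : ndi c.2 = map val (enum (dirs c)).
Proof.
rewrite /ndi -val_enum_ord filter_map enumT; congr map.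
by apply: eq_filter => i /=; rewrite inE.
Qed.

Lemma cdimE c : cdim c = #|dirs c|.
Proof. by rewrite /cdim ndiE size_map cardE. Qed.

Lemma cdim_face c j b : j \in dirs c -> cdim c = (cdim (face c j b)).+1.
Proof. by move=> jc; rewrite !cdimE dirs_face (cardsD1 j (dirs c)) jc. Qed.

Lemma mem_ndi c i : (val i \in ndi c.2) = (i \in dirs c).
Proof. by rewrite ndiE (mem_map val_inj) mem_enum. Qed.

Definition vset c (x : seq bool) : {set 'I_n} :=
  [set i in dirs c | nth false x (index (val i) (ndi c.2))].

Lemma vset_sub c x : vset c x \subset dirs c.
Proof. by apply/subsetP => i; rewrite inE => /andP[]. Qed.

Lemma vertexE c x : vertex c x = vtx c (vset c x).
Proof.
apply: point_eqP => i; rewrite vtxE nth_mktuple !inE; congr (_ + _).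
by case: ifP.
Qed.

Lemma vset_surj c A : A \subset dirs c ->
  exists x : (cdim c).-tuple bool, vset c x = A.
Proof.
move=> /subsetP Ac.
have sz : size [seq k \in map val (enum A) | k <- ndi c.2] == cdim c.
  by rewrite size_map.
exists (Tuple sz); apply/setP => i; rewrite inE /=.
case ic: (i \in dirs c) => /=; last by apply/esym/negbTE/negP => /Ac; rewrite ic.
rewrite (nth_map 0%N) ?index_mem ?mem_ndi // nth_index ?mem_ndi //.
by rewrite (mem_map val_inj) mem_enum.
Qed.

Lemma cube_inP (X : seq (point n)) c :
  reflect (forall A : {set 'I_n}, A \subset dirs c -> vtx c A \in X) (cube_in X c).
Proof.
apply: (iffP forallP) => [h A /vset_surj[x <-]|h x]; first by rewrite -vertexE.
by rewrite vertexE h // vset_sub.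
Qed.

Lemma in_cubeP t p :
  reflect (exists2 A : {set 'I_n}, A \subset dirs t & p = vtx t A) (in_cube t p).
Proof.
apply: (iffP forallP) => [h|[A /subsetP At ->] i].
  exists [set i in dirs t | p`_i == t.1`_i + 1].
    by apply/subsetP => i; rewrite inE => /andP[].
  apply: point_eqP => i; rewrite vtxE !inE; have := h i.
  case: (_ =P t.1`_i + 1) => [->|_]; last by rewrite !andbF orbF addr0 => /eqP.
  by case: (nth false _ _) => //=; rewrite orbF => /eqP ->; rewrite addr0.
rewrite vtxE; case iA: (i \in A); last by rewrite addr0 eqxx.
by rewrite eqxx andbT; have := At i iA; rewrite inE => ->; rewrite orbT.
Qed.

Lemma img_eqP f s t :
  reflect ((forall A : {set 'I_n}, A \subset dirs s ->
              exists2 B : {set 'I_n}, B \subset dirs t & f (vtx s A) = vtx t B) /\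
           (forall B : {set 'I_n}, B \subset dirs t ->
              exists2 A : {set 'I_n}, A \subset dirs s & f (vtx s A) = vtx t B))
          (img_eq f s t).
Proof.
apply: (iffP andP) => -[h1 h2]; split.
- by move=> A /vset_surj[x <-]; move/forallP: h1 => /(_ x)/in_cubeP; rewrite vertexE.
- move=> B /vset_surj[y <-]; move/forallP: h2 => /(_ y)/existsP[x /eqP e].
  by exists (vset s x); rewrite ?vset_sub // -!vertexE.
- by apply/forallP => x; apply/in_cubeP; rewrite vertexE; exact: h1 (vset_sub _ _).
- apply/forallP => y; have [A As e] := h2 _ (vset_sub t y).
  by have [x Ax] := vset_surj As; apply/existsP; exists x; rewrite !vertexE Ax e.
Qed.

(** The minimal corner is the coordinatewise minimum of the vertices, and the vertex using all
    directions then reveals the directions. *)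
Lemma vtx_cube_inj s t :
  (forall A : {set 'I_n}, A \subset dirs s -> exists2 B : {set 'I_n}, B \subset dirs t & vtx s A = vtx t B) ->
  (forall B : {set 'I_n}, B \subset dirs t -> exists2 A : {set 'I_n}, A \subset dirs s & vtx s A = vtx t B) ->
  s = t.
Proof.
move=> st ts.
have low s' t' : (forall A : {set 'I_n}, A \subset dirs s' ->
    exists2 B : {set 'I_n}, B \subset dirs t' & vtx s' A = vtx t' B) ->
    forall i, t'.1`_i <= s'.1`_i.
  move=> h i; have [B _ e] := h set0 (sub0set _).
  by rewrite -(vtx0 s') e vtxE lerDl.
have ts' B : B \subset dirs t -> exists2 A : {set 'I_n}, A \subset dirs s & vtx t B = vtx s A.
  by move=> /ts[A As e]; exists A.
have e1 : s.1 = t.1 by apply: point_eqP => i; apply/le_anti; rewrite !low.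
apply: cube_eqP => //; apply/eqP; rewrite eqEsubset; apply/andP; split.
  have [B Bt e] := st _ (subxx _).
  by have := vtx_inj (etrans e (_ : _ = vtx s B)); rewrite /vtx e1 => -> .
have [B Bt e] := ts' _ (subxx _).
by have := vtx_inj (etrans e (_ : _ = vtx t B)); rewrite /vtx -e1 => -> .
Qed.

Lemma img_eq_uniq f s t t' : img_eq f s t -> img_eq f s t' -> t = t'.
Proof.
move=> /img_eqP[h1 h2] /img_eqP[h1' h2']; apply: vtx_cube_inj.
  by move=> B /h2[A /h1'[B' B't' ->] <-]; exists B'.
by move=> B /h2'[A /h1[B' B't' ->] <-]; exists B'.
Qed.

(* A surjection between vertex sets of the same cardinal [2 ^ q]. *)
Lemma img_eq_inj f s t : cdim t = cdim s -> img_eq f s t ->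
  forall A B, A \subset dirs s -> B \subset dirs s ->
  f (vtx s A) = f (vtx s B) -> A = B.
Proof.
move=> dim /img_eqP[h1 h2].
pose h A := [set i in dirs t | (f (vtx s A))`_i == t.1`_i + 1].
have hE A B : B \subset dirs t -> f (vtx s A) = vtx t B -> h A = B.
  move=> /subsetP Bt e; apply/setP => i; rewrite !inE e vtxE.
  case iB: (i \in B); first by rewrite eqxx andbT; have := Bt i iB; rewrite inE.
  by rewrite addr0 andbC -subr_eq0 opprD addNKr.
have hinj : {in powerset (dirs s) &, injective h}.
  apply/imset_injP; rewrite eqn_leq leq_imset_card /=.
  apply: (@leq_trans #|powerset (dirs t)|).
    by rewrite !card_powerset -!cdimE dim.
  apply/subset_leq_card/subsetP => B; rewrite inE => Bt.
  have [A As e] := h2 B Bt; apply/imsetP; exists A; first by rewrite inE.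
  by rewrite (hE A B).
move=> A B As Bs e; apply: hinj; rewrite ?inE //; by rewrite /h e.
Qed.

End Cubes.

(** * The boundary operator *)

Section Boundary.
Variable n : nat.
Implicit Types (p : point n) (c s t : cube n) (A B D E : {set 'I_n}) (i j : 'I_n).
Implicit Types (X : seq (point n)).

(** Increasing enumeration by ordinals, as needed to index permutations, matrices and minors. *)
Definition enumerates q (e : 'I_q -> 'I_n) (D : {set 'I_n}) : Prop :=
  {homo e : l m / (l < m)%N} /\ D = [set e l | l : 'I_q].

Lemma enumerates_inj q (e : 'I_q -> 'I_n) D : enumerates e D -> injective e.
Proof.
move=> [mono _] l m elm; apply: val_inj.
by case: (ltngtP (val l) (val m)) => // /mono; rewrite elm ltnn.
Qed.

Lemma ndi_enumerates q (e : 'I_q -> 'I_n) c : enumerates e (dirs c) ->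
  ndi c.2 = [seq val (e l) | l <- enum 'I_q].
Proof.
move=> [mono De]; apply: (irr_sorted_eq ltn_trans ltnn).
- exact/sorted_filter/iota_ltn_sorted/ltn_trans.
- apply: (@homo_sorted _ _ (val \o e) (fun l m : 'I_q => (l < m)%N) ltn mono).
  by have := iota_ltn_sorted 0 q; rewrite -val_enum_ord sorted_map.
move=> k; rewrite ndiE De; apply/mapP/mapP => -[].
  by move=> i; rewrite mem_enum => /imsetP[l _ ->] ->; exists l; rewrite ?mem_enum.
by move=> l _ ->; exists (e l); rewrite // mem_enum imset_f.
Qed.

Lemma nth_ndi q (e : 'I_q -> 'I_n) c (l : 'I_q) : enumerates e (dirs c) ->
  nth 0%N (ndi c.2) l = e l.
Proof.
move=> en; rewrite (ndi_enumerates en) (nth_map l) ?size_enum_ord //.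
by rewrite nth_ord_enum.
Qed.

Lemma cdim_enumerates q (e : 'I_q -> 'I_n) c : enumerates e (dirs c) -> cdim c = q.
Proof. by move=> /ndi_enumerates; rewrite /cdim => ->; rewrite size_map size_enum_ord. Qed.

Lemma enumerates_ex c q : cdim c = q ->
  exists e : 'I_q -> 'I_n, enumerates e (dirs c).
Proof.
rewrite cdimE => <-; exists enum_val; split=> [l m lm|]; last first.
  apply/setP => i; apply/idP/imsetP => [ic|[l _ ->]]; last exact: enum_valP.
  by exists (enum_rank_in ic i); rewrite // enum_rankK_in.
rewrite /enum_val !(set_nth_default (enum_default l)) -?cardE //.
have srt : sorted ltn (map val (enum (dirs c))).
  by rewrite -ndiE; apply/sorted_filter/iota_ltn_sorted/ltn_trans.
have := sorted_ltn_nth ltn_trans 0%N srt; rewrite /ltn /=.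
move/(_ l m); rewrite !inE size_map -cardE !(nth_map (enum_default l)) -?cardE //.
by apply.
Qed.

(** Dropping a direction is composition with [lift], the reindexing used for minors; this links
    faces to Laplace expansion. *)
Lemma enumerates_lift q (e : 'I_q.+1 -> 'I_n) D l : enumerates e D ->
  enumerates (e \o lift l) (D :\ e l).
Proof.
move=> en; have einj := enumerates_inj en; case: en => mono ->; split.
  move=> a b ab; apply: mono; rewrite /= /bump.
  by move: ab; case: leqP; case: leqP => /=; lia.
apply/setP => i; rewrite !inE; apply/andP/imsetP => [[il /imsetP[m _ im]]|[m _ ->]].
  have lm : l != m by apply: contraNneq il => ->; rewrite im.
  by have [m' mE _] := unlift_some lm; exists m'; rewrite //= -mE.
by split; [rewrite (inj_eq einj) eq_sym neq_lift | apply/imsetP; exists (lift l m)].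
Qed.

Definition sgn D j : rat := (-1) ^+ #|[set k in D | (k < j)%N]|.

Lemma sgn_enumerates q (e : 'I_q -> 'I_n) D l : enumerates e D ->
  sgn D (e l) = (-1) ^+ l.
Proof.
move=> en; have einj := enumerates_inj en; case: en => mono ->; congr (_ ^+ _).
have -> : [set k in [set e l0 | l0 : 'I_q] | (k < e l)%N] =
          e @: [set m : 'I_q | (m < l)%N].
  apply/setP => k; rewrite !inE; apply/andP/imsetP.
    move=> [/imsetP[m _ ->] lt]; exists m; rewrite // inE ltnNge leq_eqVlt.
    by apply/negP => /orP[/eqP/val_inj lm|/mono]; [move: lt; rewrite lm ltnn|lia].
  by move=> [m]; rewrite inE => /mono lt ->; rewrite imset_f.
rewrite card_imset // -sum1_card (eq_bigl (fun m : 'I_q => (m < l)%N)); last first.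
  by move=> m; rewrite inE.
by rewrite -(big_ord_widen q (fun=> 1%N) (ltnW (ltn_ord l))) sum1_card card_ord.
Qed.

(** Incidence number of a facet. The leading minus is there because the boundary formula numbers
    directions from 1, whereas [sgn] counts from 0. *)
Definition fsgn c j (b : bool) : rat := - (sgn (dirs c) j * (-1) ^+ b).

Lemma bcoefE s t :
  bcoef s t = \sum_(j in dirs s) \sum_(b : bool) fsgn s j b * (face s j b == t)%:R.
Proof.
have [e en] := enumerates_ex (erefl (cdim s)).
have einj := enumerates_inj en.
rewrite [in RHS]en.2 big_imset /=; last by move=> ? ? _ _ /einj.
apply: eq_bigr => l _; rewrite (nth_ndi l en) faceAE faceBE big_bool /fsgn.
rewrite (sgn_enumerates _ en) exprS /=; ring.
Qed.

Lemma mem_cubes X q c : (c \in cubes X q) = (cdim c == q) && cube_in X c.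
Proof.
rewrite mem_undup mem_filter; apply: andb_idr => /andP[_ cX].
apply/allpairsP; exists c; rewrite mem_enum; split=> //.
  by rewrite -vtx0; apply: (cube_inP _ _ cX); rewrite sub0set.
by case: (c).
Qed.

Lemma face_cube_in X c j b : j \in dirs c -> cube_in X c -> cube_in X (face c j b).
Proof.
move=> jc /cube_inP cX; apply/cube_inP => A; rewrite dirs_face subsetD1 => /andP[Ac jA].
by rewrite vtx_face //; apply: cX; case: b; rewrite // subUset sub1set jc.
Qed.

Lemma mem_cubes_face X q c j b :
  j \in dirs c -> c \in cubes X q.+1 -> face c j b \in cubes X q.
Proof.
move=> jc; rewrite !mem_cubes => /andP[/eqP dc cX].
by rewrite face_cube_in // andbT -eqSS -cdim_face // dc.
Qed.

Lemma sum_delta (T : eqType) (r : seq T) (g : T -> rat) x : uniq r ->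
  \sum_(y <- r) (x == y)%:R * g y = (x \in r)%:R * g x.
Proof.
move=> ur; case xr: (x \in r).
  rewrite (big_rem x xr) /= eqxx big1_seq ?addr0 // => y /=.
  by rewrite mem_rem_uniq // inE eq_sym => /andP[/negbTE -> _]; rewrite mul0r.
rewrite mul0r big1_seq // => y /= yr; case: eqP => [xy|_]; last by rewrite mul0r.
by rewrite xy yr in xr.
Qed.

Lemma sum_bcoef X q s (g : cube n -> rat) : s \in cubes X q.+1 ->
  \sum_(s' <- cubes X q) bcoef s s' * g s' =
  \sum_(j in dirs s) \sum_(b : bool) fsgn s j b * g (face s j b).
Proof.
move=> sX; under eq_bigr do rewrite bcoefE mulr_suml.
rewrite exchange_big; apply: eq_bigr => j js /=.
under eq_bigr do rewrite mulr_suml.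
rewrite exchange_big; apply: eq_bigr => b _ /=.
under eq_bigr do rewrite -mulrA.
by rewrite -mulr_sumr sum_delta ?undup_uniq // mem_cubes_face // mul1r.
Qed.

Lemma sgnD1 D j k : j \in D -> sgn (D :\ j) k = sgn D k * (-1) ^+ (j < k)%N.
Proof.
move=> jD; rewrite /sgn (cardsD1 j [set _ in D | _]) !inE jD /= exprD mulrAC -expr2.
rewrite sqrr_sign mul1r; congr (_ ^+ #|pred_of_set _|).
by apply/setP => i; rewrite !inE andbA.
Qed.

Lemma face_comm s j k b b' : j != k ->
  face (face s j b) k b' = face (face s k b') j b.
Proof.
move=> jk; apply: cube_eqP; last first.
  by rewrite !dirs_face; apply/setP => i; rewrite !inE andbCA.
by apply: point_eqP => i; rewrite !face1E addrAC.
Qed.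

(** Removing [j] and [k] in either order leads to the same face, but removing the smaller first
    shifts the position of the larger by one, so the two contributions cancel. *)
Lemma bcoef_bcoef X q s t : s \in cubes X q.+1 ->
  \sum_(s' <- cubes X q) bcoef s s' * bcoef s' t = 0.
Proof.
move=> sX; rewrite (sum_bcoef (fun s' => bcoef s' t) sX).
pose g j k := \sum_(b : bool) \sum_(b' : bool)
  fsgn s j b * (fsgn (face s j b) k b' * (face (face s j b) k b' == t)%:R).
have -> : \sum_(j in dirs s) \sum_(b : bool) fsgn s j b * bcoef (face s j b) t =
    \sum_(j in dirs s) \sum_(k in dirs s | k != j) g j k.
  apply: eq_bigr => j js; rewrite exchange_big; apply: eq_bigr => b _ /=.
  rewrite bcoefE mulr_sumr; apply: eq_big => [k|k _]; last by rewrite mulr_sumr.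
  by rewrite dirs_face !inE andbC.
have anti j k : j \in dirs s -> k \in dirs s -> k != j -> g j k = - g k j.
  move=> js ks kj; rewrite /g [in RHS]exchange_big -sumrN; apply: eq_bigr => b _ /=.
  rewrite -sumrN; apply: eq_bigr => b' _ /=; rewrite (face_comm _ _ _ kj).
  rewrite /fsgn !dirs_face !sgnD1 //; case: ltngtP kj; last 1 first.
  - by move/val_inj => ->; rewrite eqxx.
  - by rewrite expr0 expr1 => _ _; ring.
  by rewrite expr0 expr1 => _ _; ring.
set S := \sum_(j in _) _; suff SN : S = - S.
  have: S *+ 2 = 0 by rewrite mulr2n {2}SN subrr.
  by move/eqP; rewrite mulrn_eq0 => /eqP.
rewrite {1}/S (exchange_big_dep (mem (dirs s))) /=; last by move=> j k _ /andP[].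
rewrite -sumrN; apply: eq_bigr => j js; rewrite -sumrN; apply: eq_big => k.
  by rewrite js eq_sym.
by move=> /andP[ks kj]; rewrite anti // -?andbA //; case/andP: kj.
Qed.

End Boundary.

(** * Sets of cubes without free face *)

Section NoFreeFace.
Variable n : nat.
Implicit Types (p : point n) (c s t C : cube n) (A B D E : {set 'I_n}) (i j x : 'I_n).
Implicit Types (S T : seq (cube n)).

Definition no_free_face S : Prop :=
  forall t j b, t \in S -> j \in dirs t ->
  exists t', exists j', exists b',
    [/\ t' \in S, t' <> t, j' \in dirs t' & face t' j' b' = face t j b].

(** A linear height for selecting extremal cubes. *)
Definition weight c : int := \sum_(i < n) c.1`_i.

Lemma weight_face c j b : weight (face c j b) = weight c + b%:Z.
Proof.
rewrite /weight; under eq_bigr do rewrite face1E.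
rewrite big_split /=; congr (_ + _); rewrite (bigD1 j) //= eqxx big1 ?addr0 //.
by move=> i /negbTE ->.
Qed.

Lemma dirs_face_eq c t j j' b b' : j' \in dirs t ->
  face t j' b' = face c j b -> dirs t = j' |: (dirs c :\ j).
Proof. by move=> j't e; rewrite -(dirs_face _ _ b) -e dirs_face setD1K. Qed.

Lemma corner_face_eq c t j j' b b' i : face t j' b' = face c j b ->
  t.1`_i + ((i == j') && b')%:Z = c.1`_i + ((i == j) && b)%:Z.
Proof. by move=> e; rewrite -!face1E e. Qed.

Lemma face_recover c t j b : j \in dirs c -> j \in dirs t ->
  face t j b = face c j b -> t = c.
Proof.
move=> jc jt e; apply: cube_eqP; last by rewrite (dirs_face_eq jt e) setD1K.
by apply: point_eqP => i; apply: (addIr ((i == j) && b)%:Z); exact: corner_face_eq e.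
Qed.

(** The side [b] is the same for both cubes: this excludes the neighbour of [c] obtained by
    translation along [j], which meets [c] on opposite sides. *)
Lemma face_eq_new_dir c t j j' b : j \in dirs c -> j' \in dirs t -> t <> c ->
  face t j' b = face c j b -> j' \notin dirs c.
Proof.
move=> jc j't tc e; apply/negP => j'c; have [jj'|jj'] := eqVneq j' j.
  by rewrite jj' in j't e; exact: tc (face_recover jc j't e).
have : j' \in dirs (face c j b) by rewrite dirs_face in_setD1 jj'.
by rewrite -e dirs_face in_setD1 eqxx.
Qed.

(** The upper facet of [C] has weight [weight C + 1], which no cube of [S] reaches with a lower
    facet. The neighbour thus also meets it from below and must have a new direction. *)
Lemma top_link S C j : no_free_face S -> C \in S ->
    (forall t, t \in S -> weight t <= weight C) -> j \in dirs C ->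
  exists t, exists x, [/\ t \in S, x \notin dirs C, dirs t = x |: (dirs C :\ j)
    & forall i, t.1`_i + (i == x)%:Z = C.1`_i + (i == j)%:Z].
Proof.
move=> Sfree CS Cmax jC; have [t [x [b [tS tC xt e]]]] := Sfree C j true CS jC.
have bT : b = true.
  by have := congr1 weight e; have := Cmax t tS; rewrite !weight_face; case: b {e}; lia.
rewrite {}bT in e.
exists t, x; split=> //; [exact: face_eq_new_dir e | exact: dirs_face_eq e |].
by move=> i; have := corner_face_eq i e; rewrite !andbT.
Qed.

Lemma bot_link S C j : no_free_face S -> C \in S ->
    (forall t, t \in S -> weight C <= weight t) -> j \in dirs C ->
  exists t, exists x,
    [/\ t \in S, x \notin dirs C, dirs t = x |: (dirs C :\ j) & t.1 = C.1].
Proof.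
move=> Sfree CS Cmin jC; have [t [x [b [tS tC xt e]]]] := Sfree C j false CS jC.
have bF : b = false.
  by have := congr1 weight e; have := Cmin t tS; rewrite !weight_face; case: b {e}; lia.
rewrite {}bF in e.
exists t, x; split=> //; [exact: face_eq_new_dir e | exact: dirs_face_eq e |].
by apply: point_eqP => i; have := corner_face_eq i e; rewrite !andbF !addr0.
Qed.

(** The cubes are told apart by the directions of [C] that they miss: none for [C], exactly [j] for
    its neighbour at [j]. *)
Lemma size_link T C : C \in T ->
    (forall j, j \in dirs C -> exists t, exists x,
       [/\ t \in T, x \notin dirs C & dirs t = x |: (dirs C :\ j)]) ->
  (#|dirs C| < size T)%N.
Proof.
move=> CT link; set D := dirs C.
rewrite -(size_map (fun c => D :\: dirs c) T) cardE -(size_map (@set1 'I_n)).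
set L := map _ (enum D); rewrite -[(size L).+1]/(size (set0 :: L)).
apply: uniq_leq_size => [|Y].
  rewrite /= map_inj_uniq ?enum_uniq ?andbT; last exact: set1_inj.
  by apply/mapP => -[j _] /setP/(_ j); rewrite !inE eqxx.
rewrite inE => /orP[/eqP ->|/mapP[j]]; first by apply/mapP; exists C; rewrite ?setDv.
rewrite mem_enum => jD ->; have [t [x [tT xD dt]]] := link j jD.
apply/mapP; exists t => //; apply/setP => i; rewrite dt in_setD in_setU1 in_setD1 in_set1 -/D.
have [->|ij] := eqVneq i j.
  by rewrite orbF jD andbT; apply/esym; apply: contraNneq xD => <-.
by case: (i \in D); rewrite ?andbF ?orbT.
Qed.

Lemma ex_max_seq (T : eqType) (w : T -> int) (r : seq T) : r != [::] ->
  exists2 y : T, y \in r & forall z : T, z \in r -> w z <= w y.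
Proof.
elim: r => // a [|b r] IH _; first by exists a => [|z]; rewrite inE // => /eqP ->.
have [y yr ymax] := IH isT; have [le|lt] := leP (w a) (w y).
  exists y; first by rewrite inE yr orbT.
  by move=> z; rewrite inE => /orP[/eqP -> //|/ymax].
exists a; first exact: mem_head.
move=> z; rewrite inE => /orP[/eqP -> //|/ymax le].
exact: le_trans le (ltW lt).
Qed.

(* At the top corner [v] and at the bottom corner [u] (extremal for the sum of
   coordinates) every cube of [S] is extremal, and its faces through the corner
   produce [k] further cubes there.  The two corners share at most the cube
   [[u, v]], and in that case an opposite face yields one more cube. *)
Lemma no_free_face_size S k : uniq S -> S != [::] -> no_free_face S ->
  (0 < k)%N -> (forall t, t \in S -> cdim t = k) -> (k.+1.*2 <= size S)%N.
Proof.
move=> uS S0 Sfree k0 Sk.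
have [C CS Cmax] := ex_max_seq weight S0.
have [C' C'S C'min'] := ex_max_seq (fun c => - weight c) S0.
have C'min t : t \in S -> weight C' <= weight t by move=> /C'min'; rewrite lerN2.
pose top c := vtx c (dirs c).
have topE c i : (top c)`_i = c.1`_i + (i \in dirs c)%:Z by exact: vtxE.
pose av c := top c == top C; pose au c := c.1 == C'.1.
have link_top C0 j : C0 \in S -> (forall t, t \in S -> weight t <= weight C0) ->
    top C0 = top C -> j \in dirs C0 -> exists t, exists x,
    [/\ t \in S, x \notin dirs C0, dirs t = x |: (dirs C0 :\ j), av t
      & forall i, t.1`_i + (i == x)%:Z = C0.1`_i + (i == j)%:Z].
  move=> C0S C0max tC jC0; have [t [x [tS xC dt t1]]] := top_link Sfree C0S C0max jC0.
  exists t, x; split=> //; rewrite /av -tC; apply/eqP/point_eqP => i.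
  rewrite !topE dt in_setU1 in_setD1; have := t1 i.
  have [ix|ix] := eqVneq i x; have [ij|ij] := eqVneq i j => /=.
  - by rewrite -ix ij jC0 in xC.
  - by rewrite ix (negbTE xC).
  - by rewrite ij jC0.
  - by rewrite !addr0 => ->.
have szv : (k < count av S)%N.
  rewrite -size_filter -(Sk C CS) cdimE; apply: size_link.
    by rewrite mem_filter /av eqxx.
  move=> j /(link_top C j CS Cmax (erefl _))[t [x [tS xC dt vt _]]].
  by exists t, x; rewrite mem_filter vt tS.
have szu : (k < count au S)%N.
  rewrite -size_filter -(Sk C' C'S) cdimE; apply: size_link.
    by rewrite mem_filter /au eqxx.
  move=> j jC; have [t [x [tS xC dt t1]]] := bot_link Sfree C'S C'min jC.
  by exists t, x; rewrite mem_filter /au t1 eqxx tS.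
have UI := count_predUI av au S.
have Usz := count_size (predU av au) S.
have [/hasP[c0 c0S /andP[/eqP vc0 /eqP uc0]]|] := boolP (has (predI av au) S); last first.
  by rewrite has_count; lia.
have [C0 [C0S v0 u0]] : exists C0, [/\ C0 \in S, top C0 = top C & C0.1 = C'.1].
  by exists c0.

have I1 : (count (predI av au) S <= 1)%N.
  rewrite -size_filter; apply: (@uniq_leq_size _ _ [:: C0]); first exact: filter_uniq.
  move=> c; rewrite mem_filter => /andP[/andP[/eqP vc /eqP uc] _].
  suff -> : c = C0 by rewrite mem_head.
  apply: (@cube_eqP n); first by rewrite uc u0.
  apply: (@vtx_inj _ C0); rewrite -/(top C0) v0 -vc.
  by apply: point_eqP => i; rewrite topE vtxE uc u0.
suff: has (predC (predU av au)) S.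
  by rewrite has_count; have := count_predC (predU av au) S; lia.
(* In a fixed dimension, equal top corners give equal weights, so [C0] is as extremal as [C] and has
   upper neighbours too. *)
have weight_top c : weight c = \sum_(i < n) (top c)`_i - (cdim c)%:Z.
  under eq_bigr do rewrite topE -[X in _ + X]natz.
  rewrite big_split /= -natr_sum natz cdimE -sum1_card [in X in _ - X]big_mkcond /=.
  rewrite /weight -addrA [X in _ + X](_ : _ = 0) ?addr0 //; apply/eqP.
  by rewrite subr_eq0; apply/eqP; congr (Posz _); apply: eq_bigr => i _; case: (i \in _).
have C0max t : t \in S -> weight t <= weight C0.
  by move=> tS; have := Cmax t tS; rewrite !weight_top v0 !Sk.
have [j jC0] : exists j, j \in dirs C0.
  by apply/set0Pn; rewrite -card_gt0 -cdimE Sk.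
(* Both corners of [C0] have the same coordinate at the new direction [x], and [t] reaches one unit
   below it. The neighbour [t'] across the lower facet of [t] along [x] stays strictly below that
   value, so it contains neither corner. *)
have [t [x [tS xC0 dt vt t1]]] := link_top C0 j C0S C0max v0 jC0.
have below (a d e : int) (be ga : bool) : (ga <= be)%N ->
    d + true%:Z = e + false%:Z -> a + be%:Z = d -> a + ga%:Z = e + false%:Z -> False.
  by case: be; case: ga => //= _; lia.
have xt : x \in dirs t by rewrite dt setU11.
have [t' [x' [b [t'S t't x't' e]]]] := Sfree t x false tS xt.
apply/hasP; exists t' => //=; apply/negP => /orP[/eqP vt'|/eqP ut'].
all: have ex := corner_face_eq x e.
all: have xj : x != j by apply: contraNneq xC0 => ->.
all: have := t1 x; rewrite eqxx (negbTE xj) => t1x.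
all: rewrite eqxx /= addr0 in ex.
- have := congr1 (fun p : point n => p`_x) vt'; rewrite -v0 /= !topE (negbTE xC0).
  rewrite (dirs_face_eq x't' e) in_setU1 in_setD1 eqxx orbF => ex'.
  have [xx'|nx] := eqVneq x x'; last first.
    by rewrite (negbTE nx) in ex ex'; exact: (below _ _ _ false false _ t1x ex ex').
  rewrite xx' eqxx /= in ex ex'; case: b e ex => e ex; last first.
    by rewrite -xx' in e x't'; exact: t't (face_recover xt x't' e).
  by rewrite xx' in t1x; exact: (below _ _ _ true true _ t1x ex ex').
- have := congr1 (fun p : point n => p`_x) ut'; rewrite -u0 /= -[LHS]addr0 -[RHS]addr0.
  exact: (below _ _ _ _ false _ t1x ex).
Qed.

End NoFreeFace.

(** * Cubes mapped onto cubes *)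

Section AffineMaps.
Variable n : nat.
Implicit Types (p w : point n) (c s t : cube n) (A B D E : {set 'I_n}) (i j k : 'I_n).
Implicit Types (f : point n -> point n) (J : 'I_n -> 'I_n).

Definition coord p i : int := p`_i.

Lemma coord_eqP p w : (forall i, coord p i = coord w i) -> p = w.
Proof. exact: point_eqP. Qed.

(** Continuity is used through the bound 1 on this taxicab distance; lower bounds by two or three of
    its terms reduce the geometry to linear arithmetic. *)
Definition dist p w : int := \sum_(i < n) `|coord p i - coord w i|.

Lemma dist_one p w i : `|coord p i - coord w i| <= dist p w.
Proof. by rewrite /dist (bigD1 i) //= lerDl sumr_ge0. Qed.

Lemma dist_two p w i k : i != k ->
  `|coord p i - coord w i| + `|coord p k - coord w k| <= dist p w.
Proof.
move=> ik; rewrite /dist (bigD1 i) //= (bigD1 k) 1?eq_sym //= addrA.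
by rewrite lerDl sumr_ge0.
Qed.

Lemma dist_three p w i k l : i != k -> i != l -> k != l ->
  `|coord p i - coord w i| + `|coord p k - coord w k| + `|coord p l - coord w l| <= dist p w.
Proof.
move=> ik il kl; rewrite /dist (bigD1 i) //= (bigD1 k) 1?eq_sym //=.
by rewrite (bigD1 l) /= 1?[l == i]eq_sym 1?[l == k]eq_sym ?il ?kl // !addrA lerDl sumr_ge0.
Qed.

Lemma c1adjeq_dist p w : c1adjeq p w -> dist p w <= 1.
Proof.
case/orP=> [/eqP ->|/existsP[i /andP[/eqP d1 /forallP d0]]].
  by rewrite /dist big1 // => i _; rewrite subrr normr0.
rewrite /dist /coord (bigD1 i) //= d1 big1 // => j ji.
by have := d0 j; rewrite ji => /eqP ->; rewrite subrr normr0.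
Qed.

Definition step k (e : bool) i : int := if i == k then if e then -1 else 1 else 0.

Lemma dist_le1_step p w : dist p w <= 1 -> p <> w ->
  exists ke : 'I_n * bool, forall i, coord w i = coord p i + step ke.1 ke.2 i.
Proof.
move=> d pw.
have [k kd] : exists k : 'I_n, coord p k <> coord w k :> int.
  have [/existsP[k /eqP]|/existsPn h] := boolP [exists k : 'I_n, coord p k != coord w k].
    by exists k.
  case: pw; apply: coord_eqP => i.
  by apply/eqP; have := h i; rewrite negbK.
exists (k, (coord w k < coord p k)) => i; rewrite /step /=; have [->|ik] := eqVneq i k.
  by have := dist_one p w k; case: ltP => /=; lia.
by have := dist_two p w ik; lia.
Qed.

(** The midpoint of two points at distance 2 on a line is unique. This excludes a square unfolded
    along one axis. *)
Lemma dist_le1_opposite p p1 p2 w k e : dist p1 w <= 1 -> dist p2 w <= 1 ->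
  (forall i, coord p1 i = coord p i + step k e i) -> (forall i, coord p2 i = coord p i + step k (~~ e) i) ->
  w = p.
Proof.
move=> d1 d2 s1 s2; apply: coord_eqP => i.
have [->|ik] := eqVneq i k.
  have := dist_one p1 w k; have := dist_one p2 w k.
  by rewrite s1 s2 /step eqxx; case: e {s1 s2} => /=; lia.
have := dist_two p1 w ik; have := dist_two p2 w ik.
rewrite !s1 !s2 /step eqxx (negbTE ik).
by case: e {s1 s2} => /=; lia.
Qed.

(** Completion of a unit square: the diagonal points [p1] and [p2] have only the other two corners
    as common neighbours. *)
Lemma dist_le1_corner p p1 p2 w k e l g : k != l -> dist p1 w <= 1 -> dist p2 w <= 1 ->
  (forall i, coord p1 i = coord p i + step k e i) -> (forall i, coord p2 i = coord p i + step l g i) ->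
  p <> w -> forall i, coord w i = coord p i + step k e i + step l g i.
Proof.
move=> kl d1 d2 s1 s2 pw.
have lk : l == k = false by rewrite eq_sym (negbTE kl).
have off i : i != k -> i != l -> coord w i = coord p i.
  move=> ik il; have := dist_three p1 w ik il kl; have := dist_three p2 w ik il kl.
  rewrite !s1 !s2 /step !eqxx lk (negbTE kl) (negbTE ik) (negbTE il).
  by case: e {s1}; case: g {s2}; lia.
have := dist_two p1 w kl; have := dist_two p2 w kl.
rewrite !s1 !s2 /step !eqxx lk (negbTE kl) => h2 h1.
have on : (coord w k = coord p k + if e then -1 else 1) /\ (coord w l = coord p l + if g then -1 else 1).
  have [ek|nk] := eqVneq (coord w k : int) (coord p k); last first.
    by case: e {s1} h1 h2; case: g {s2}; lia.
  have [el|nl] := eqVneq (coord w l : int) (coord p l); last first.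
    by case: e {s1} h1 h2; case: g {s2}; lia.
  case: pw; apply: coord_eqP => i; have [->//|ik] := eqVneq i k.
  by have [->//|il] := eqVneq i l; rewrite off.
move=> i; have [->|ik] := eqVneq i k; first by rewrite (negbTE kl) addr0 on.1.
by have [->|il] := eqVneq i l; rewrite ?addr0 ?on.2 // off // !addr0.
Qed.

Definition flip D A E : {set 'I_n} := [set j in D | (j \in A) (+) (j \in E)].

(** A signed permutation in terms of sets: direction [j] is carried to [J j], reversed when [j] is
    in [E]. Here [J] goes from source to target, inversely to the permutation in [fsign]. *)
Definition amap f s t J E : Prop :=
  [/\ {in dirs s &, injective J}, dirs t = J @: dirs s &
      forall A, A \subset dirs s -> f (vtx s A) = vtx t (J @: flip (dirs s) A E)].

Lemma in_flip D A E j : (j \in flip D A E) = (j \in D) && ((j \in A) (+) (j \in E)).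
Proof. by rewrite in_set. Qed.

Lemma flip_sub D A E : flip D A E \subset D.
Proof. by apply/subsetP => i; rewrite inE => /andP[]. Qed.

Lemma mem_imset_dom J D A j : {in D &, injective J} -> A \subset D -> j \in D ->
  (J j \in J @: A) = (j \in A).
Proof.
move=> Ji /subsetP AD jD; apply/imsetP/idP => [[i iA e]|jA]; last by exists j.
by rewrite (Ji j i jD (AD i iA) e).
Qed.

Lemma amap_cdim f s t J E : amap f s t J E -> cdim t = cdim s.
Proof. by case=> Ji dt _; rewrite !cdimE dt card_in_imset. Qed.

Lemma amap_img_eq f s t J E : amap f s t J E -> img_eq f s t.
Proof.
case=> Ji dt fA; apply/img_eqP; split=> [A As|B Bt].
  by exists (J @: flip (dirs s) A E); rewrite ?fA // dt imsetS // flip_sub.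
exists [set j in dirs s | (J j \in B) (+) (j \in E)].
  by apply/subsetP => i; rewrite inE => /andP[].
rewrite fA; last by apply/subsetP => i; rewrite inE => /andP[].
congr vtx; apply/setP => i; apply/imsetP/idP => [[j]|iB].
  by rewrite in_flip => /andP[js]; rewrite in_set js -addbA addbb addbF => ? ->.
have := subsetP Bt i iB; rewrite dt => /imsetP[j js ij].
by exists j => //; rewrite in_flip js in_set js /= -ij iB -addbA addbb addbF.
Qed.

(** A reversed direction exchanges the two sides, hence the [(+)]; the same [J] and [E] serve for
    every face. *)
Lemma amap_face f s t J E j b : amap f s t J E -> j \in dirs s ->
  amap f (face s j b) (face t (J j) (b (+) (j \in E))) J E.
Proof.
case=> Ji dt fA js; split.
- by rewrite dirs_face => x y; rewrite !in_setD1 => /andP[_ xs] /andP[_ ys]; apply: Ji.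
- rewrite !dirs_face dt; apply/setP => i; rewrite in_setD1; apply/andP/imsetP.
    move=> [ij /imsetP[x xs ix]]; exists x => //; rewrite in_setD1 xs andbT.
    by apply: contraNneq ij => <-; rewrite ix.
  move=> [x]; rewrite in_setD1 => /andP[xj xs] ->; rewrite imset_f //; split=> //.
  by apply: contraNneq xj => /Ji ->.
move=> A; rewrite dirs_face subsetD1 => /andP[As jA].
rewrite !vtx_face //; last first.
  apply/imsetP => -[x]; rewrite in_flip in_setD1 => /andP[/andP[xj xs] _] /Ji jx.
  by rewrite jx ?eqxx // in xj.
rewrite fA; last by case: b; rewrite // subUset sub1set js.
have -> : flip (dirs s) (if b then j |: A else A) E =
    if b (+) (j \in E) then j |: flip (dirs s :\ j) A E else flip (dirs s :\ j) A E.
  apply/setP => i; have [->|ij] := eqVneq i j.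
    rewrite in_flip js /=; have -> : (j \in if b then j |: A else A) = b.
      by case: b; rewrite ?setU11 // (negbTE jA).
    by case: ifP => _; rewrite ?setU11 // in_flip setD11.
  have -> : (i \in if b (+) (j \in E) then j |: flip (dirs s :\ j) A E
      else flip (dirs s :\ j) A E) = (i \in flip (dirs s :\ j) A E).
    by case: ifP => _; rewrite // in_setU1 (negbTE ij).
  rewrite !in_flip in_setD1 ij /=; congr (_ && (_ (+) _)).
  by case: (b); rewrite // in_setU1 (negbTE ij).
by case: ifP => _; rewrite // imsetU1.
Qed.

Definition locally_injective f s : Prop :=
  forall A B, A \subset dirs s -> B \subset dirs s ->
    (#|(A :\: B) :|: (B :\: A)| <= 2)%N -> f (vtx s A) = f (vtx s B) -> A = B.

Definition locally_continuous f s : Prop :=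
  forall A j, A \subset dirs s -> j \in dirs s ->
  dist (f (vtx s A)) (f (vtx s (j |: A))) <= 1.

(** The edges at the base vertex give unit steps. Any further vertex is the last corner of a square
    whose other corners use fewer directions, so induction on the size of [A] applies. *)
Lemma locally_injective_affine f s : locally_continuous f s -> locally_injective f s ->
  exists J (e : 'I_n -> bool), {in dirs s &, injective J} /\
  forall A, A \subset dirs s -> forall i,
    coord (f (vtx s A)) i = coord (f (vtx s set0)) i + \sum_(j in A) step (J j) (e j) i.
Proof.
move=> cont linj; set phi := fun A => f (vtx s A).
have card2 (A B : {set 'I_n}) j k : (A :\: B) :|: (B :\: A) \subset [set j; k] ->
    (#|(A :\: B) :|: (B :\: A)| <= 2)%N.
  by move=> /subset_leq_card h; apply: leq_trans h _; rewrite cards2; case: (_ != _).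
have [Je JeP] : exists Je : 'I_n -> 'I_n * bool, forall j, j \in dirs s ->
    forall i, coord (phi [set j]) i = coord (phi set0) i + step (Je j).1 (Je j).2 i.
  apply: (@fin_all_exists _ (fun=> _) (fun j (y : 'I_n * bool) => j \in dirs s ->
    forall i, coord (phi [set j]) i = coord (phi set0) i + step y.1 y.2 i)) => j.
  have [js|_] := boolP (j \in dirs s); last by exists (j, false).
  have := cont set0 j (sub0set _) js; rewrite setU0 => /dist_le1_step.
  case=> [|ke keP]; last by exists ke.
  move=> e; have /setP/(_ j) : set0 = [set j]; last by rewrite !inE eqxx.
  apply: linj e; rewrite ?sub0set ?sub1set //; apply: (card2 _ _ j j).
  by rewrite set0D setD0 set0U setUid.
pose J j := (Je j).1; pose e j := (Je j).2; exists J, e.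
(* If [j] and [k] had the same axis, equal signs would identify two neighbours of the base vertex,
   and opposite signs would send the far corner of their square back to the image of the base
   vertex. *)
have Jinj : {in dirs s &, injective J}.
  move=> j k js ks Jjk; apply/eqP/negPn/negP => jk.
  have jks : [set j; k] \subset dirs s by rewrite subUset !sub1set js.
  have [ejk|ejk] := eqVneq (e j) (e k).
    have eq : phi [set j] = phi [set k].
      by apply: coord_eqP => i; rewrite !JeP // -/(J j) -/(J k) -/(e j) Jjk ejk.
    have /setP/(_ j) : [set j] = [set k]; last by rewrite !inE eqxx (negbTE jk).
    apply: linj eq; rewrite ?sub1set //; apply: (card2 _ _ j k).
    by apply/subsetP => i; rewrite !inE; case: eqP; case: eqP.
  have eq : phi [set j; k] = phi set0.
    apply: (@dist_le1_opposite _ (phi [set j]) (phi [set k]) _ (J j) (e j)).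
    - by rewrite setUC; apply: cont; rewrite ?sub1set.
    - by apply: cont; rewrite ?sub1set.
    - exact: JeP.
    - move=> i; rewrite JeP // -/(J k) -/(e k) Jjk; congr (_ + step _ _ _).
      by move: ejk; case: (e j); case: (e k).
  have /setP/(_ j) : [set j; k] = set0; last by rewrite !inE eqxx.
  apply: linj eq; rewrite ?sub0set //; apply: (card2 _ _ j k).
  by rewrite set0D setD0 setU0.
split=> // A; have [m] := ubnP #|A|; elim: m A => // m IH A Am As i; rewrite -!/(phi _).
have [->|/set0Pn[j jA]] := eqVneq A set0; first by rewrite big_set0 addr0.
have js := subsetP As j jA.
have [A1|/set0Pn[k kA]] := eqVneq (A :\ j) set0.
  by rewrite -(setD1K jA) A1 setU0 big_set1 JeP.
pose B := A :\ j :\ k; move: (kA); rewrite in_setD1 => /andP[kj kA'].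
have ks := subsetP As k kA'.
have jB : j \notin B by rewrite !inE eqxx andbF.
have kB : k \notin B by rewrite !inE eqxx.
have Bs : B \subset dirs s 
  by apply/subsetP => x; rewrite !in_setD1 => /and3P[_ _ /(subsetP As)].
have AE : A = j |: (k |: B) by rewrite !setD1K.
clearbody B; have cA : #|A| = #|B|.+2.
  by rewrite AE cardsU1 in_setU1 eq_sym (negbTE kj) (negbTE jB) cardsU1 kB.
have jBs : j |: B \subset dirs s by rewrite subUset sub1set js.
have kBs : k |: B \subset dirs s by rewrite subUset sub1set ks.
have phiB i' : coord (phi B) i' = coord (phi set0) i' + \sum_(l in B) step (J l) (e l) i'.
  by apply: IH => //; lia.
have phij i' : coord (phi (j |: B)) i' = coord (phi B) i' + step (J j) (e j) i'.
  rewrite IH //; last by rewrite cardsU1 jB; lia.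
  by rewrite phiB big_setU1 //=; ring.
have phik i' : coord (phi (k |: B)) i' = coord (phi B) i' + step (J k) (e k) i'.
  rewrite IH //; last by rewrite cardsU1 kB; lia.
  by rewrite phiB big_setU1 //=; ring.
rewrite AE (@dist_le1_corner (phi B) (phi (j |: B)) (phi (k |: B)) _ (J j) (e j) (J k) (e k)) //.
- rewrite big_setU1 /=; last by rewrite in_setU1 eq_sym (negbTE kj).
  by rewrite big_setU1 //= phiB; ring.
- by apply: contraNneq kj => /Jinj ->.
- by rewrite setUCA; apply: cont.
- exact: cont.
move=> eq; suff BA : B = A by rewrite -BA (negbTE jB) in jA.
apply: linj; rewrite -?AE // in eq *; apply: (card2 _ _ j k).
apply/subsetP => x; rewrite AE !in_setU !in_setD !in_setU !in_set1.
by case: (x \in B); case: (x == j); case: (x == k).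
Qed.

Lemma locally_injective_amap f s : locally_continuous f s -> locally_injective f s ->
  exists t, exists J, exists E, amap f s t J E.
Proof.
move=> cont linj; have [J [e [Ji aff]]] := locally_injective_affine cont linj.
pose E := [set j in dirs s | e j].
have Es : E \subset dirs s by apply/subsetP => i; rewrite inE => /andP[].
(* Along a reversed direction the base vertex is sent to the upper end, so the minimal corner lies
   one unit below. *)
pose t : cube n := ([tuple (f (vtx s set0))`_i - (i \in J @: E)%:Z | i < n],
                    [tuple i \in J @: dirs s | i < n]).
have dt : dirs t = J @: dirs s by exact: dirs_mk.
exists t, J, E; split=> // A As; apply: point_eqP => i.
rewrite -[LHS]/(coord _ _) aff // /coord vtxE nth_mktuple -addrA; congr (_ + _).
have [/imsetP[j js ->]|ni] := boolP (i \in J @: dirs s); last first.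
  have no (Y : {set 'I_n}) : Y \subset dirs s -> (i \in J @: Y) = false.
    by move=> Ys; apply: contraNF ni => iY; apply: subsetP iY; rewrite imsetS.
  rewrite !no ?flip_sub //= big1 // => j jA; rewrite /step; case: eqP => // ij.
  by rewrite ij imset_f // (subsetP As) in ni.
rewrite !(mem_imset_dom Ji) ?flip_sub //.
rewrite in_flip ![j \in E]in_set js /=.
rewrite (eq_bigr (fun k => if k == j then if e j then -1 else 1 else 0)); last first.
  move=> k kA; rewrite /step; have [->|kj] := eqVneq k j; first by rewrite eqxx.
  case: eqP => // /Ji jk; have ks := subsetP As k kA.
  by rewrite jk // eqxx in kj.
rewrite -big_mkcondr /=; case jA: (j \in A).
  rewrite (big_pred1 j) => [|k]; first by case: (e j).
  by rewrite /= andbC; case: eqP => // ->.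
rewrite big_pred0 => [|k]; first by case: (e j).
by case: eqP => [->|_]; rewrite ?jA ?andbF.
Qed.

Lemma img_eq_amap f s t : locally_continuous f s -> cdim t = cdim s ->
  img_eq f s t -> exists J, exists E, amap f s t J E.
Proof.
move=> cont dim img.
have linj : locally_injective f s by move=> A B As Bs _; exact: img_eq_inj img A B As Bs.
have [t' [J [E am]]] := locally_injective_amap cont linj.
by exists J, E; rewrite (img_eq_uniq img (amap_img_eq am)).
Qed.

Lemma c1_continuous_local (X : seq (point n)) f s :
  c1_continuous X f -> cube_in X s -> locally_continuous f s.
Proof.
move=> [fX fc] /cube_inP sX A j As js; have jAs : j |: A \subset dirs s.
  by rewrite subUset sub1set js.
have [jA|jA] := boolP (j \in A).
  by rewrite (setUidPr _) ?sub1set // c1adjeq_dist // /c1adjeq eqxx.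
apply: c1adjeq_dist; apply: fc; [exact: sX | exact: sX |].
apply/existsP; exists j; rewrite !vtxE setU11 (negbTE jA) addr0 opprD addrA subrr add0r.
rewrite normrN normr1 eqxx /=; apply/forallP => k; apply/implyP => kj.
by rewrite !vtxE in_setU1 (negbTE kj).
Qed.

End AffineMaps.

(** * Signs *)

Section Signs.
Variable n : nat.
Implicit Types (p w : point n) (c s t : cube n) (A B D E : {set 'I_n}) (i j k : 'I_n).
Implicit Types (f : point n -> point n) (J : 'I_n -> 'I_n).

Definition amap_mx q (e e' : 'I_q -> 'I_n) J E : 'M[rat]_q :=
  \matrix_(l, m) ((J (e l) == e' m)%:R * (-1) ^+ (e l \in E)).

Lemma prod_sign_count q (c : q.-tuple bool) :
  \prod_(i < q) (-1) ^+ tnth c i = (-1) ^+ count id c :> rat.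
Proof.
by rewrite -expr_sum -sum1_count big_tuple [in RHS]big_mkcond /=; congr (_ ^+ _).
Qed.

Lemma mem_vset q (e : 'I_q -> 'I_n) s (x : seq bool) l : enumerates e (dirs s) ->
  (e l \in vset s x) = nth false x l.
Proof.
move=> en; rewrite in_set en.2 imset_f //= -(nth_ndi l en) index_uniq //.
  by rewrite -/(cdim s) (cdim_enumerates en).
by rewrite filter_uniq // iota_uniq.
Qed.

Lemma nth_coords q (e : 'I_q -> 'I_n) t B (i : 'I_q) : enumerates e (dirs t) ->
  nth false (coords t (vtx t B)) i = (e i \in B).
Proof.
move=> en; rewrite (nth_map 0%N) ?(nth_ndi i en); last first.
  by rewrite -/(cdim t) (cdim_enumerates en).
rewrite vtxE; case: (e i \in B); first by rewrite eqxx.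
by rewrite addr0 -subr_eq0 opprD addNKr.
Qed.

(** The pair found by [pick] is unique: the all-false tuple reveals the flips, indicator tuples the
    permutation. The matrix is transposed because [pi] runs from target to source. *)
Lemma fsign_det q (e e' : 'I_q -> 'I_n) f s t J E :
  enumerates e (dirs s) -> enumerates e' (dirs t) -> amap f s t J E ->
  fsign f s t = \det (amap_mx e e' J E).
Proof.
move=> en en' [Ji dt fA]; have qE := cdim_enumerates en; subst q.
have es l : e l \in dirs s by rewrite en.2 imset_f.
have [K KP] : exists K : 'I_(cdim s) -> 'I_(cdim s), forall m, J (e (K m)) = e' m.
  apply: (@fin_all_exists _ (fun=> _) (fun m l => J (e l) = e' m)) => m.
  have : e' m \in dirs t by rewrite en'.2 imset_f.
  by rewrite dt en.2 -imset_comp => /imsetP[l _ ->]; exists l.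
have Kinj : injective K.
  by move=> a b ab; apply: (enumerates_inj en'); rewrite -!KP ab.
have coordE (x : (cdim s).-tuple bool) (m : 'I_(cdim s)) :
    nth false (coords t (f (vertex s x))) m = tnth x (K m) (+) (e (K m) \in E).
  rewrite vertexE fA ?vset_sub // (nth_coords _ _ en') -KP.
  rewrite (mem_imset_dom Ji) ?flip_sub // in_flip es /= (mem_vset _ _ en).
  by rewrite (tnth_nth false).
rewrite /fsign; case: pickP => [[pi c] /= /forallP h|]; last first.
  move=> /(_ (perm Kinj, [tuple e (K m) \in E | m < cdim s])) /negP[].
  apply/forallP => x; apply/forallP => m /=.
  by rewrite coordE permE tnth_mktuple.
have {}h x m : tnth x (K m) (+) (e (K m) \in E) = tnth x (pi m) (+) tnth c m.
  by have /forallP/(_ m)/eqP := h x; rewrite coordE.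
have cE m : tnth c m = (e (K m) \in E).
  by have := h [tuple false | _ < cdim s] m; rewrite !tnth_mktuple.
have piE m : pi m = K m.
  have := h [tuple l == K m | l < cdim s] m; rewrite !tnth_mktuple eqxx cE.
  by move/addIb/esym/eqP.
rewrite -det_tr -prod_sign_count -det_perm mulrC.
have -> : (amap_mx e e' J E)^T =
    diag_mx (\row_m (-1) ^+ tnth c m) *m perm_mx pi.
  apply/matrixP => m l; rewrite mul_diag_mx !mxE mulrC cE piE -KP.
  rewrite (inj_in_eq Ji) // (inj_eq (enumerates_inj en)).
  by have [->|kl] := eqVneq (K m) l; rewrite ?mul1r ?mulr1 ?(mul0r, mulr0).
rewrite det_mulmx det_diag; congr (_ * _); apply: eq_bigr => m _.
by rewrite mxE.
Qed.

(* Laplace expansion along the row of [j], whose only nonzero entry is in the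
   column of [J j]. *)
Lemma amap_face_sign f s t J E j b : amap f s t J E -> j \in dirs s ->
  fsgn s j b * fsign f (face s j b) (face t (J j) (b (+) (j \in E))) =
  fsign f s t * fsgn t (J j) (b (+) (j \in E)).
Proof.
move=> am js; have amf := amap_face b am js.
have ds := cdim_face b js; have dt := etrans (amap_cdim am) ds.
move: ds dt; set q := cdim (face s j b) => ds dt.
have [e en] := enumerates_ex ds; have [e' en'] := enumerates_ex dt.
have := js; rewrite en.2 => /imsetP[l _ jl].
have Jjt : J j \in dirs t by case: am => _ -> _; rewrite imset_f.
have := Jjt; rewrite en'.2 => /imsetP[m _ jm].
have enl := enumerates_lift l en; rewrite -jl -(dirs_face s j b) in enl.
have enm := enumerates_lift m en'.
rewrite -jm -(dirs_face t (J j) (b (+) (j \in E))) in enm.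
rewrite (fsign_det en en' am) (fsign_det enl enm amf).
rewrite (expand_det_row _ l) (bigD1 m) //= big1 ?addr0 => [|m' m'm]; last first.
  by rewrite mxE -jl jm (inj_eq (enumerates_inj en')) eq_sym (negbTE m'm) !mul0r.
rewrite mxE -jl -jm eqxx mul1r /cofactor.
have -> : row' l (col' m (amap_mx e e' J E)) = amap_mx (e \o lift l) (e' \o lift m) J E.
  by apply/matrixP => a a'; rewrite !mxE.
(* The cofactor sign [(-1) ^+ (l + m)] compensates the two positions, and the sign of the matrix
   entry compensates the exchange of sides. *)
rewrite /fsgn {1}jl jm (sgn_enumerates _ en) (sgn_enumerates _ en').
rewrite exprD signr_addb; have := sqrr_sign rat m; have := sqrr_sign rat (j \in E).
move: (_ ^+ m) (_ ^+ (j \in E)) (\det _) (_ ^+ l) (_ ^+ b) => x y d u v y2 x2.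
transitivity (- (u * v * d) * x ^+ 2 * y ^+ 2); first by rewrite x2 y2; ring.
ring.
Qed.

End Signs.

(** * The chain map property *)

Section ChainMap.
Variables (n : nat) (X : seq (point n)) (f : point n -> point n).
Hypothesis fX : c1_continuous X f.
Implicit Types (c s t r : cube n) (A B : {set 'I_n}) (j k : 'I_n).

Lemma img_eq_cube_in s t : cube_in X s -> img_eq f s t -> cube_in X t.
Proof.
move=> /cube_inP sX /img_eqP[_ h]; apply/cube_inP => B /h[A As <-].
by apply: (proj1 fX); exact: sX.
Qed.

Lemma mem_cubes_img q s t : s \in cubes X q -> cdim t = cdim s -> img_eq f s t ->
  t \in cubes X q.
Proof.
by rewrite !mem_cubes => /andP[/eqP <- sX] -> img; rewrite eqxx (img_eq_cube_in sX img).
Qed.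

Lemma fcoefE s t t1 : cdim t = cdim s -> img_eq f s t ->
  fcoef f s t1 = (t == t1)%:R * fsign f s t.
Proof.
move=> dim img; rewrite /fcoef; have [<-|tt1] := eqVneq t t1.
  by rewrite dim eqxx img mul1r.
rewrite mul0r; case: andP => // -[_ /(img_eq_uniq img) e].
by rewrite e eqxx in tt1.
Qed.

Lemma fcoef_neq0 s t : fcoef f s t != 0 -> cdim t = cdim s /\ img_eq f s t.
Proof. by rewrite /fcoef; case: andP => [[/eqP]|]; rewrite ?eqxx. Qed.

Lemma bcoef_neq0 t r : bcoef t r != 0 ->
  exists j, exists2 b, j \in dirs t & face t j b = r.
Proof.
move=> nz.
have [/existsP[j /existsP[b /andP[jt /eqP e]]]|no] :=
  boolP [exists j, exists b, (j \in dirs t) && (face t j b == r)].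
  by exists j, b.
case/eqP: nz; rewrite bcoefE big1 // => j jt; rewrite big1 // => b _.
case: eqP => [e|_]; last by rewrite mulr0.
case/negP: no; apply/existsP; exists j; apply/existsP; exists b.
by rewrite jt e eqxx.
Qed.

(** Facets of a cube are pairwise distinct, so nothing cancels in the coefficient. *)
Lemma bcoef_face t j b : j \in dirs t -> bcoef t (face t j b) != 0.
Proof.
move=> jt; rewrite bcoefE (bigD1 j) //= (bigD1 b) //= eqxx mulr1.
rewrite !big1 ?addr0; first by rewrite oppr_eq0 mulf_neq0 ?signr_eq0.
- move=> k /andP[kt kj]; rewrite big1 // => b' _; case: eqP => [e|_]; rewrite ?mulr0 //.
  by have [e' _] := face_inj kt jt e; rewrite e' eqxx in kj.
- move=> b' b'b; case: eqP => [e|_]; rewrite ?mulr0 //.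
  by have [_ e'] := face_inj jt jt e; rewrite e' eqxx in b'b.
Qed.

Lemma chain_map_amap q s t t' J E : s \in cubes X q.+1 -> amap f s t J E ->
  \sum_(s' <- cubes X q) bcoef s s' * fcoef f s' t' =
  \sum_(t1 <- cubes X q.+1) fcoef f s t1 * bcoef t1 t'.
Proof.
move=> sX am; have dim := amap_cdim am; have img := amap_img_eq am.
rewrite (sum_bcoef (fun s' => fcoef f s' t') sX).
under [RHS]eq_bigr do rewrite (fcoefE _ dim img) -mulrA.
rewrite (sum_delta (fun t1 => fsign f s t * bcoef t1 t')) ?undup_uniq //.
rewrite (mem_cubes_img sX dim img) mul1r bcoefE mulr_sumr.
have [Ji dt _] := am; rewrite dt big_imset //=; apply: eq_bigr => j js.
rewrite mulr_sumr [in RHS](reindex_inj (@addIb (j \in E))) /=; apply: eq_bigr => b _.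
have amf := amap_face b am js.
rewrite (fcoefE _ (amap_cdim amf) (amap_img_eq amf)) mulrCA (amap_face_sign b am js).
by rewrite mulrC mulrA.
Qed.

Lemma locally_injective_cube q s : s \in cubes X q -> locally_injective f s ->
  exists2 t, t \in cubes X q & exists J, exists E, amap f s t J E.
Proof.
move=> sX linj; have cont : locally_continuous f s.
  by apply: (c1_continuous_local fX); move: sX; rewrite mem_cubes => /andP[].
have [t [J [E am]]] := locally_injective_amap cont linj.
exists t; last by exists J, E.
exact: mem_cubes_img sX (amap_cdim am) (amap_img_eq am).
Qed.

(** The edge is collapsed, so its two ends, of opposite signs in the boundary, have the same
    image. *)
Lemma chain_map_dim1 s t' : s \in cubes X 1 -> ~ locally_injective f s ->
  \sum_(s' <- cubes X 0) bcoef s s' * fcoef f s' t' = 0.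
Proof.
move=> sX ninj; rewrite (sum_bcoef (fun s' => fcoef f s' t') sX).
have := sX; rewrite mem_cubes => /andP[ds _].
have /cards1P[j sj] : #|dirs s| == 1%N by rewrite -cdimE.
have js : j \in dirs s by rewrite sj set11.
have eqf : f (vtx s set0) = f (vtx s [set j]).
  have [//|ne] := eqVneq (f (vtx s set0)) (f (vtx s [set j])).
  case: ninj => A B; rewrite sj !subset1 => /orP[]/eqP -> /orP[]/eqP -> // _ e.
    by rewrite e eqxx in ne.
  by rewrite e eqxx in ne.
pose t : cube n := (f (vtx s set0), [tuple i \in set0 | i < n]).
have t0 : dirs t = set0 by exact: dirs_mk.
have f0 b : dirs (face s j b) = set0 by rewrite dirs_face sj setDv.
have am b : amap f (face s j b) t id set0.
  split; rewrite ?f0 ?t0 ?imset0 //.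
  move=> A; rewrite subset0 => /eqP ->; rewrite vtx_face ?inE //.
  have -> : flip set0 set0 set0 = set0 :> {set 'I_n}.
    by apply/setP => x; rewrite !inE.
  by rewrite imset0 vtx0 /=; case: b; rewrite // setU0 -eqf.
have en0 c : dirs c = set0 -> enumerates (fun i : 'I_0 => widen_ord (leq0n n) i) (dirs c).
  by move=> ->; split=> [[]//|]; apply/setP => i; rewrite inE; apply/esym/imsetP => -[[]].
rewrite big1 // => k; rewrite sj inE => /eqP ->; rewrite big_bool.
rewrite !(fcoefE _ (amap_cdim (am _)) (amap_img_eq (am _))).
rewrite !(fsign_det (en0 _ (f0 _)) (en0 _ t0) (am _)) !det_mx00 /fsgn.
by rewrite /= expr0 expr1; ring.
Qed.

Lemma face_vtx_sub s j b A : j \in dirs s -> A \subset dirs (face s j b) ->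
  exists B, [/\ B \subset dirs s, (j \in B) = b & vtx (face s j b) A = vtx s B].
Proof.
move=> js; rewrite dirs_face subsetD1 => /andP[As jA].
exists (if b then j |: A else A); rewrite vtx_face //; split=> //.
  by case: b; rewrite // subUset sub1set js.
by case: b; rewrite ?setU11 // (negbTE jA).
Qed.

Lemma vtx_face_sup s j A : A \subset dirs s ->
  A :\ j \subset dirs (face s j (j \in A)) /\
  vtx (face s j (j \in A)) (A :\ j) = vtx s A.
Proof.
move=> As; rewrite dirs_face setSD //; split=> //; rewrite vtx_face ?setD11 //.
case: ifP => [jA|jA]; first by rewrite setD1K.
by congr vtx; apply/setP => x; rewrite in_setD1; have [->|] := eqVneq x j.
Qed.

Lemma img_eq_same s s' t :
  (forall A, A \subset dirs s ->
     exists2 B : {set 'I_n}, B \subset dirs s' & f (vtx s A) = f (vtx s' B)) ->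
  (forall B, B \subset dirs s' ->
     exists2 A : {set 'I_n}, A \subset dirs s & f (vtx s A) = f (vtx s' B)) ->
  img_eq f s t -> img_eq f s' t.
Proof.
move=> h1 h2 /img_eqP[i1 i2]; apply/img_eqP; split.
  by move=> B /h2[A /i1[C Ct e] <-]; exists C.
by move=> C /i2[A /h1[B Bs' e] <-]; exists B.
Qed.

(** Vertices that agree in some direction lie in a common facet, where [f] is injective. Otherwise
    [s] is a square and [A], [B] are diagonal; if they had the same image, the two edges joining
    them to a third vertex would have equal images. *)
Lemma faces_locally_injective s : (1 < cdim s)%N ->
  (forall j b, j \in dirs s -> exists2 t, cdim t = cdim (face s j b) &
     img_eq f (face s j b) t) ->
  (forall j b k b' t, j \in dirs s -> k \in dirs s -> img_eq f (face s j b) t ->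
     img_eq f (face s k b') t -> j = k) ->
  locally_injective f s.
Proof.
move=> s1 img dist A B As Bs card2 e.
have AB j : (j \in (A :\: B) :|: (B :\: A)) = ((j \in A) != (j \in B)).
  by rewrite in_setU !in_setD; case: (j \in A); case: (j \in B).
have [/subsetPn[j js]|] := boolP (~~ (dirs s \subset (A :\: B) :|: (B :\: A))).
  rewrite AB negbK => /eqP jAB.
  have [t dim im] := img j (j \in A) js.
  have [Af vA] := vtx_face_sup j As; have [Bf vB] := vtx_face_sup j Bs.
  rewrite -jAB in Bf vB; have /setP ABj : A :\ j = B :\ j.
    by apply: (img_eq_inj dim im Af Bf); rewrite vA vB.
  apply/setP => i; have := ABj i; rewrite !in_setD1.
  by have [->|] := eqVneq i j.
rewrite negbK => sub.
have /cards2P[j [k [jk sE]]] : #|dirs s| == 2%N.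
  by rewrite eqn_leq -cdimE s1 andbT cdimE (leq_trans (subset_leq_card sub)).
have js : j \in dirs s by rewrite sE set21.
have ks : k \in dirs s by rewrite sE set22.
have jAB : (j \in A) = ~~ (j \in B).
  by have := subsetP sub j js; rewrite AB; case: (j \in A); case: (j \in B).
have kAB : (k \in A) = ~~ (k \in B).
  by have := subsetP sub k ks; rewrite AB; case: (k \in A); case: (k \in B).
have ext (C C' : {set 'I_n}) : C \subset dirs s -> C' \subset dirs s ->
    (j \in C) = (j \in C') -> (k \in C) = (k \in C') -> C = C'.
  move=> Cs C's jC kC; apply/setP => i.
  have [|ni] := boolP (i \in dirs s); first by rewrite sE in_set2 => /orP[]/eqP ->.
  by rewrite (contraNF (subsetP Cs i) ni) (contraNF (subsetP C's i) ni).
have [t _ im] := img k (k \in A) ks.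
suff im' : img_eq f (face s j (j \in B)) t.
  by have := dist _ _ _ _ _ js ks im' im; move/eqP: jk.
apply: img_eq_same im => C Cf.
  have [D [Ds kD ->]] := face_vtx_sub ks Cf.
  have [jD|jD] := eqVneq (j \in D) (j \in B).
    have [Df vD] := vtx_face_sup j Ds; rewrite jD in Df vD.
    by exists (D :\ j); rewrite ?vD.
  have -> : D = A by apply: ext => //; rewrite jAB; move: jD; case: (j \in D); case: (j \in B).
  by have [Bf vB] := vtx_face_sup j Bs; exists (B :\ j); rewrite ?vB.
have [D [Ds jD ->]] := face_vtx_sub js Cf.
have [kD|kD] := eqVneq (k \in D) (k \in A).
  have [Df vD] := vtx_face_sup k Ds; rewrite kD in Df vD.
  by exists (D :\ k); rewrite ?vD.
have -> : D = B.
  by apply: ext => //; move: kD; rewrite kAB; case: (k \in D); case: (k \in B).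
by have [Af vA] := vtx_face_sup k As; exists (A :\ k); rewrite ?vA.
Qed.

(** In operator form, the boundary of [f] of the boundary of [s] equals [f] of the double boundary,
    which is zero. *)
Lemma chain_map_cycle q s r : s \in cubes X q.+2 ->
  (forall s', s' \in cubes X q.+1 ->
    \sum_(s'' <- cubes X q) bcoef s' s'' * fcoef f s'' r =
    \sum_(t1 <- cubes X q.+1) fcoef f s' t1 * bcoef t1 r) ->
  \sum_(t1 <- cubes X q.+1)
     (\sum_(s' <- cubes X q.+1) bcoef s s' * fcoef f s' t1) * bcoef t1 r = 0.
Proof.
move=> sX IH; under eq_bigr do rewrite mulr_suml.
rewrite exchange_big /=.
under eq_bigr => s' _ do (under eq_bigr => t1 _ do rewrite -mulrA); under eq_bigr do rewrite -mulr_sumr.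
rewrite (eq_big_seq (fun s' => \sum_(s'' <- cubes X q) (bcoef s s' * bcoef s' s'') * fcoef f s'' r)); last first.
  by move=> s' s'X /=; rewrite -IH // mulr_sumr; apply: eq_bigr => s'' _; rewrite mulrA.
rewrite exchange_big big1 //= => s'' _.
by rewrite -mulr_suml (bcoef_bcoef _ sX) mul0r.
Qed.

(* If [f s] is not a cube, the support of the cycle [f (boundary s)] has no free
   face, so if nonempty it has at least [2 (q + 2)] elements: every face of [s] is then
   mapped to a cube, and distinct faces to distinct cubes. *)
Lemma chain_map_degenerate q s t' : s \in cubes X q.+2 -> t' \in cubes X q.+1 ->
  ~ locally_injective f s ->
  (forall r, r \in cubes X q -> forall s', s' \in cubes X q.+1 ->
    \sum_(s'' <- cubes X q) bcoef s' s'' * fcoef f s'' r =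
    \sum_(t1 <- cubes X q.+1) fcoef f s' t1 * bcoef t1 r) ->
  \sum_(s' <- cubes X q.+1) bcoef s s' * fcoef f s' t' = 0.
Proof.
move=> sX t'X ninj IH.
pose z t1 := \sum_(s' <- cubes X q.+1) bcoef s s' * fcoef f s' t1.
apply/eqP; rewrite -/(z t') -[_ == _]negbK; apply/negP => zt'.
have ds : cdim s = q.+2 by move: sX; rewrite mem_cubes => /andP[/eqP].
pose S := [seq t1 <- cubes X q.+1 | z t1 != 0].
have uS : uniq S by rewrite filter_uniq ?undup_uniq.
have SX t1 : t1 \in S -> t1 \in cubes X q.+1 by rewrite mem_filter => /andP[].
have Sdim t1 : t1 \in S -> cdim t1 = q.+1.
  by move=> /SX; rewrite mem_cubes => /andP[/eqP].
have Sfree : no_free_face S.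
  move=> t j b tS jt; set r := face t j b.
  have rX : r \in cubes X q by rewrite mem_cubes_face // SX.
  have [/hasP[t1 t1S /andP[/eqP t1t]]|no] :=
      boolP (has (fun t1 => (t1 != t) && (bcoef t1 r != 0)) S).
    by move=> /bcoef_neq0[j' [b' j't1 e]]; exists t1, j', b'.
  (* If [t] alone had the facet [r], this sum would reduce to one nonzero term. *)
  have : \sum_(t1 <- cubes X q.+1) z t1 * bcoef t1 r = 0.
    exact: chain_map_cycle sX (IH r rX).
  rewrite (big_rem t) /= ?SX // big1_seq ?addr0; last first.
    move=> t1 /=; rewrite mem_rem_uniq ?undup_uniq // inE => /andP[t1t t1X].
    apply/eqP; rewrite mulf_eq0; have [//|zt1] := eqVneq (z t1) 0.
    apply: contraNT no => nz; apply/hasP; exists t1; last by rewrite t1t.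
    by rewrite mem_filter zt1.
  move/eqP; rewrite mulf_eq0 (negbTE (bcoef_face _ jt)) orbF.
  by move: tS; rewrite mem_filter => /andP[/negbTE ->].
have S0 : S != [::] by apply: contraTneq (_ : t' \in S) => [->//|]; rewrite mem_filter zt'.
have szS := no_free_face_size uS S0 Sfree (ltn0Sn _) Sdim.
pose I := setX (dirs s) [set: bool].
(* [None] stands for a facet whose image is not in [S]; [img_eq_uniq] makes the choice of the head
   immaterial. *)
pose h (jb : 'I_n * bool) := ohead [seq t1 <- S | img_eq f (face s jb.1 jb.2) t1].
have hE j b t1 : t1 \in S -> img_eq f (face s j b) t1 -> h (j, b) = Some t1.
  move=> t1S im; rewrite /h /=; case E: [seq _ <- _ | _] => [|t2 L].
    have : t1 \in [seq t2 <- S | img_eq f (face s j b) t2] by rewrite mem_filter im.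
    by rewrite E.
  have : t2 \in [seq t2 <- S | img_eq f (face s j b) t2] by rewrite E mem_head.
  by rewrite mem_filter => /andP[/(img_eq_uniq im) -> _].
have Sh : {subset map Some S <= map h (enum I)}.
  move=> _ /mapP[t1 t1S ->].
  have : z t1 != 0 by move: t1S; rewrite mem_filter => /andP[].
  rewrite /z (sum_bcoef (fun s' => fcoef f s' t1) sX) => nz.
  have [/existsP[j /existsP[b /andP[js nzjb]]]|no] :=
      boolP [exists j, exists b, (j \in dirs s) && (fcoef f (face s j b) t1 != 0)].
    have [_ im] := fcoef_neq0 nzjb.
    by apply/mapP; exists (j, b); rewrite ?(hE j b t1) // mem_enum !inE /= andbT; rewrite inE in js.
  case/eqP: nz; rewrite big1 // => j js; rewrite big1 // => b _.
  have [->|nzjb] := eqVneq (fcoef f (face s j b) t1) 0; first by rewrite mulr0.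
  by case/negP: no; apply/existsP; exists j; apply/existsP; exists b; rewrite js.
have uSome : uniq (map Some S) by rewrite map_inj_uniq // => ? ? [].
(* The [2 (q + 2)] facets cover a set of at least as many cubes, so [h] never takes the value [None]
   and is injective. *)
have szI : (size (map h (enum I)) <= size (map Some S))%N.
  rewrite !size_map -cardE cardsX cardsT card_bool -cdimE ds.
  by rewrite muln2.
have [_ Shi] := uniq_min_size uSome Sh szI.
have /dinjectiveP hinj : dinjectiveb h I.
  exact: leq_size_uniq uSome Sh szI.
have inI j b : j \in dirs s -> (j, b) \in I by move=> js; rewrite in_setX js in_setT.
have himg j b : j \in dirs s -> exists2 t1, t1 \in S & img_eq f (face s j b) t1.
  move=> js; have : h (j, b) \in map Some S by rewrite Shi map_f // mem_enum inI.
  case/mapP=> t1 t1S; rewrite /h /=; case E: [seq _ <- _ | _] => [//|t2 L] [e].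
  have : t1 \in t2 :: L by rewrite e mem_head.
  by rewrite -E mem_filter => /andP[im _]; exists t1.
apply: ninj; apply: faces_locally_injective; first by rewrite ds.
  move=> j b js; have [t1 t1S im] := himg j b js; exists t1 => //.
  by apply/eqP; rewrite (Sdim t1 t1S) -eqSS -(cdim_face b js) ds.
move=> j b k b' t js ks imj imk; have [t1 t1S im1] := himg j b js.
have t1t := img_eq_uniq im1 imj; rewrite -t1t in imk.
have := hinj (j, b) (k, b') (inI j b js) (inI k b' ks).
by rewrite (hE j b t1) // (hE k b' t1) // => /(_ (erefl _)) [].
Qed.

Lemma chain_map_cases q s t' : s \in cubes X q.+1 ->
  (~ locally_injective f s ->
     \sum_(s' <- cubes X q) bcoef s s' * fcoef f s' t' = 0) ->
  \sum_(s' <- cubes X q) bcoef s s' * fcoef f s' t' =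
  \sum_(t1 <- cubes X q.+1) fcoef f s t1 * bcoef t1 t'.
Proof.
move=> sX degenerate; have [/hasP[t tX im]|no] := boolP (has (img_eq f s) (cubes X q.+1)).
  have sin : cube_in X s by move: sX; rewrite mem_cubes => /andP[].
  have dim : cdim t = cdim s.
    by move: tX sX; rewrite !mem_cubes => /andP[/eqP -> _] /andP[/eqP ->].
  have [J [E am]] := img_eq_amap (c1_continuous_local fX sin) dim im.
  exact: chain_map_amap am.
rewrite degenerate; last first.
  move=> /(locally_injective_cube sX)[t tX [J [E am]]]; case/hasP: no.
  by exists t; rewrite // (amap_img_eq am).
rewrite big1_seq // => t1 /= t1X; have /hasPn/(_ _ t1X)/negbTE im := no.
by rewrite /fcoef im andbF mul0r.
Qed.

Lemma chain_map q s t' : s \in cubes X q.+1 -> t' \in cubes X q ->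
  \sum_(s' <- cubes X q) bcoef s s' * fcoef f s' t' =
  \sum_(t1 <- cubes X q.+1) fcoef f s t1 * bcoef t1 t'.
Proof.
elim: q s t' => [|q IH] s t' sX t'X; apply: chain_map_cases => // ninj.
  exact: chain_map_dim1.
by apply: chain_map_degenerate => // r rX s' s'X; exact: IH.
Qed.

End ChainMap.

(** * The Lefschetz number *)

Section Lefschetz.
Variables (n : nat) (X : seq (point n)) (f : point n -> point n).

Lemma sum_cubes q (g : cube n -> rat) :
  \sum_(i < ncubes X q) g (nth (cube0 n) (cubes X q) i) = \sum_(c <- cubes X q) g c.
Proof. by rewrite (big_nth (cube0 n)) big_mkord. Qed.

(** Since [0.-1] is [0], this matrix goes from [0]-cubes to [0]-cubes; it still represents the zero
    boundary in degree 0. *)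
Lemma bdmx0 : bdmx X 0 = 0.
Proof.
apply/matrixP => i j; rewrite !mxE bcoefE.
have : nth (cube0 n) (cubes X 0) i \in cubes X 0 by rewrite mem_nth.
rewrite mem_cubes cdimE => /andP[]; rewrite cards_eq0 => /eqP -> _.
by rewrite big_set0.
Qed.

Lemma bdmx_bdmx q : bdmx X q.+1 *m bdmx X q = 0.
Proof.
case: q => [|q]; first by rewrite bdmx0 mulmx0.
apply/matrixP => i j; rewrite !mxE; under eq_bigr do rewrite !mxE.
rewrite (sum_cubes _ (fun c => bcoef (nth (cube0 n) (cubes X q.+2) i) c *
  bcoef c (nth (cube0 n) (cubes X q) j))).
by rewrite (@bcoef_bcoef _ X) // mem_nth.
Qed.

Lemma mxtrace_dim0 m (M : 'M[rat]_m) : m = 0%N -> \tr M = 0.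
Proof. by move=> m0; subst m; rewrite /mxtrace big_ord0. Qed.

Lemma ncubes_gtn : ncubes X n.+1 = 0%N.
Proof.
apply/eqP; rewrite size_eq0; case E: (cubes X n.+1) => [//|c L].
have : c \in cubes X n.+1 by rewrite E mem_head.
rewrite mem_cubes cdimE => /andP[/eqP cn _].
by have := max_card (mem (dirs c)); rewrite cn card_ord ltnn.
Qed.

Hypothesis fX : c1_continuous X f.

Lemma chmx_bdmx q : chmx X f q *m bdmx X q = bdmx X q *m chmx X f q.-1.
Proof.
case: q => [|q]; first by rewrite bdmx0 mulmx0 mul0mx.
apply/matrixP => i j; rewrite !mxE; under eq_bigr do rewrite !mxE.
under [RHS]eq_bigr do rewrite !mxE.
set s := nth _ (cubes X q.+1) i; set t' := nth _ (cubes X q) j.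
rewrite (sum_cubes _ (fun c => fcoef f s c * bcoef c t')).
rewrite (sum_cubes _ (fun c => bcoef s c * fcoef f c t')).
by rewrite (chain_map fX) // mem_nth.
Qed.

Definition bd_trace q : rat :=
  \tr (row_base (bdmx X q.+1) *m chmx X f q *m pinvmx (row_base (bdmx X q.+1))).

Lemma trace_chmx q : \tr (chmx X f q) =
  htrace X f q + bd_trace q + (if q is q'.+1 then bd_trace q' else 0).
Proof.
rewrite (mxtrace_homology (bdmx_bdmx q) (chmx_bdmx q) (chmx_bdmx q.+1)).
congr (_ + _); case: q => [|//].
by apply: mxtrace_dim0; rewrite bdmx0 mxrank0.
Qed.

(** The trace on boundaries occurs in two consecutive degrees with opposite signs and telescopes;
    the last one vanishes because there are no [n.+1]-cubes. *)
Lemma lefschetz_trace :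
  lefschetz X f = \sum_(q < n.+1) (-1) ^+ q * \tr (chmx X f q).
Proof.
have tele m : \sum_(q < m.+1) (-1) ^+ q * \tr (chmx X f q) =
    \sum_(q < m.+1) (-1) ^+ q * htrace X f q + (-1) ^+ m * bd_trace m.
  elim: m => [|m IH]; first by rewrite !big_ord1 trace_chmx addr0 mulrDr.
  by rewrite big_ord_recr [in RHS]big_ord_recr /= IH trace_chmx exprS; ring.
rewrite tele [bd_trace n]mxtrace_dim0 ?mulr0 ?addr0 //.
by apply/eqP; rewrite -leqn0 -ncubes_gtn rank_leq_row.
Qed.

Lemma norm_fcoef_le c : `|fcoef f c c| <= (img_eq f c c)%:R.
Proof.
rewrite /fcoef eqxx /=; case: img_eq; last by rewrite normr0.
rewrite /fsign; case: pickP => [ps _|_]; last by rewrite normr0.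
by rewrite normrM !normr_sign mulr1.
Qed.

Lemma norm_trace_le q : `|\tr (chmx X f q)| <= (count (fun c => img_eq f c c) (cubes X q))%:R.
Proof.
apply: le_trans (ler_norm_sum _ _ _) _.
under eq_bigr do rewrite mxE.
rewrite (sum_cubes _ (fun c => `|fcoef f c c|)) -sum1_count natr_sum [X in _ <= X]big_mkcond.
apply: ler_sum => c _; apply: le_trans (norm_fcoef_le c) _.
by case: img_eq.
Qed.

Lemma sum_count_cdim m (s : seq (cube n)) :
  (\sum_(q < m) count (fun c => cdim c == q) s <= size s)%N.
Proof.
elim: s => [|c s IH]; first by rewrite big1.
rewrite /= big_split /= -add1n leq_add //.
have [cm|mc] := ltnP (cdim c) m; last first.
  rewrite big1 // => q _; case: eqP => // cq.
  by move: (ltn_ord q); rewrite -cq ltnNge mc.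
rewrite (bigD1 (Ordinal cm)) //= eqxx big1 // => q qc.
by case: eqP => // cq; case/eqP: qc; apply: val_inj.
Qed.

End Lefschetz.

Unset Implicit Arguments.

Theorem theorem5p2 (n : nat) (X : seq (point n)) (f : point n -> point n) (k : nat) :
  (n <= 4)%N ->
  c1_continuous X f ->
  `|lefschetz X f| = k%:R ->
  exists s : seq (cube n),
    [/\ uniq s, (k <= size s)%N &
        forall c, c \in s -> cube_in X c && img_eq f c c].
Proof.
move=> _ fX Lk.
pose s := [seq c <- undup [seq (a, d) | a <- X, d <- enum {: n.-tuple bool}] |
            cube_in X c && img_eq f c c].
exists s; split; [by rewrite filter_uniq ?undup_uniq | | by move=> c; rewrite mem_filter => /andP[]].
(* Sorting the invariant cubes by dimension allows a comparison degree by degree with the traces on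
   chains. *)
apply: leq_trans (sum_count_cdim n.+1 s).
rewrite -(ler_nat rat) -Lk (lefschetz_trace fX) natr_sum.
apply: le_trans (ler_norm_sum _ _ _) _; apply: ler_sum => q _.
rewrite normrM normrX normrN1 expr1n mul1r; apply: le_trans (norm_trace_le _ _ _) _.
rewrite ler_nat -!size_filter; apply: uniq_leq_size.
  by rewrite filter_uniq ?undup_uniq.
move=> c; rewrite !mem_filter => /andP[im]; rewrite im andbT.
rewrite !mem_undup mem_filter => /andP[/andP[-> ->] ->]; by [].
Qed.
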